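(* Let $M$ be a model of Presburger arithmetic $\mathbf{PrA}$ and let $L=(D_L,<_L)$ be a linear order definable in $M$. Then there exist a (standard) natural number $n$ and an $M$-definable map $f\colon D_L\to M^n$ which is an embedding of $L$ into $M^n$ equipped with the lexicographic order, i.e. for all $a,b\in D_L$, $a<_L b$ if and only if $f(a)<_{lex}f(b)$ (and $f$ is injective).
   Context: $\mathbf{PrA}$ is the elementary (complete first-order) theory of the structure $(\mathbb{Z};<,+)$. Definability in $M$ is first-order definability in the language $\{<,+\}$ with parameters from $M$. A linear order $L$ is definable in $M$ if for some $k\ge 1$ its domain $D_L\subseteq M^k$ and its strict comparison relation $<_L\,\subseteq D_L\times D_L\subseteq M^{2k}$ are $M$-definable sets. A map is $M$-definable if its graph is. The lexicographic order on $M^n$ is: $(x_0,\dots,x_{n-1})<_{lex}(y_0,\dots,y_{n-1})$ iff there is $i<n$ with $x_j=y_j$ for all $j<i$ and $x_i<y_i$ in $M$. *)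

(* Defs.v *)
From mathcomp Require Import all_boot all_order all_algebra.

Set Implicit Arguments.
Unset Strict Implicit.
Unset Printing Implicit Defensive.

Record structure : Type := Structure {
  carrier :> Type;
  slt : carrier -> carrier -> Prop;
  sadd : carrier -> carrier -> carrier }.

(* [term n] and [formula n] have their free variables among 'I_n; a quantifier
   binds variable 0 and shifts the others by one (de Bruijn indices). *)
Inductive term (n : nat) : Type :=
| TVar of 'I_n
| TAdd of term n & term n.

Inductive formula (n : nat) : Type :=
| FEq of term n & term n
| FLt of term n & term n
| FNot of formula n
| FAnd of formula n & formula n
| FOr of formula n & formula n
| FImp of formula n & formula n
| FEx of formula n.+1
| FAll of formula n.+1.

Fixpoint eval (M : structure) n (v : n.-tuple M) (t : term n) : M :=
  match t with
  | TVar i => tnth v i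
  | TAdd t1 t2 => sadd (eval v t1) (eval v t2)
  end.

Fixpoint sat (M : structure) n (v : n.-tuple M) (phi : formula n) : Prop :=
  match phi with
  | FEq t1 t2 => eval v t1 = eval v t2
  | FLt t1 t2 => slt (eval v t1) (eval v t2)
  | FNot p => ~ sat v p
  | FAnd p q => sat v p /\ sat v q
  | FOr p q => sat v p \/ sat v q
  | FImp p q => sat v p -> sat v q
  | FEx p => exists x : M, sat (cons_tuple x v) p
  | FAll p => forall x : M, sat (cons_tuple x v) p
  end.

Definition sentence := formula 0.

Definition holds (M : structure) (s : sentence) : Prop := sat (nil_tuple M) s.

Definition theory := sentence -> Prop.

Definition theory_of (M : structure) : theory := holds M.

Definition model_of (T : theory) (M : structure) : Prop :=
  forall s, T s -> holds M s.

Definition Z_structure : structure :=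
  @Structure int (fun x y => (x < y)%R) (fun x y => (x + y)%R).

Definition PrA : theory := theory_of Z_structure.

(* The tuple [p] lists the parameters of the definition. *)
Definition definable (M : structure) k (A : k.-tuple M -> Prop) : Prop :=
  exists (m : nat) (phi : formula (k + m)) (p : m.-tuple M),
    forall x, A x <-> sat (cat_tuple x p) phi.

(* M^k x M^l is identified with M^(k + l) by concatenation. *)
Definition definable_rel (M : structure) k l
    (R : k.-tuple M -> l.-tuple M -> Prop) : Prop :=
  definable (fun z : (k + l).-tuple M =>
    exists x y, z = cat_tuple x y /\ R x y).

(* A map D -> M^n is represented by a total function on M^k whose values
   outside D are irrelevant: its graph is restricted to D. *)
Definition definable_map (M : structure) k n (D : k.-tuple M -> Prop)
    (f : k.-tuple M -> n.-tuple M) : Prop :=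
  definable_rel (fun x y => D x /\ f x = y).

Record strict_linear_order (T : Type) (D : T -> Prop) (R : T -> T -> Prop) :
    Prop := StrictLinearOrder {
  slo_dom : forall a b, R a b -> D a /\ D b;
  slo_irr : forall a, ~ R a a;
  slo_trans : forall a b c, R a b -> R b c -> R a c;
  slo_total : forall a b, D a -> D b -> [\/ R a b, a = b | R b a] }.

Definition definable_linear_order (M : structure) k
    (D : k.-tuple M -> Prop) (R : k.-tuple M -> k.-tuple M -> Prop) : Prop :=
  [/\ strict_linear_order D R, definable D & definable_rel R].

Definition lex (M : structure) n (x y : n.-tuple M) : Prop :=
  exists i : 'I_n,
    (forall j : 'I_n, j < i -> tnth x j = tnth y j) /\
    slt (tnth x i) (tnth y i).

(* Main.v *)
Require Import Defs.
From mathcomp Require Import all_boot all_order all_algebra.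
From mathcomp Require Import zify ring.
From Stdlib Require Import ClassicalEpsilon FunctionalExtensionality.

(* A linear order embeds into its initial segments [{y | y < x}], ordered by
   strict inclusion, so it is enough to code the members of a definable family
   of subsets of [M^k] by tuples so that strict inclusion becomes [<_lex].  The
   tuples do not mention the order, and the claim is first-order for each fixed
   family, so it may be proved over the integers with the parameters as extra
   variables and then transferred to [M].

   Over the integers a subset of [Z^k] is a 0-1 valued function on [Z^k], and the
   variables are eliminated one at a time: a definable family of tuple-valued
   functions [phi_c] on [Z] gets tuples [F c] such that [phi_c <= phi_c']
   pointwise, with strict inequality somewhere, implies [F c <_lex F c'].  One
   may treat the coordinates of [phi_c] one after the other, and the half-lines
   [t >= 0] and [t <= 0] separately.  By quantifier elimination [phi_c (t)] lies
   on one of finitely many lines, and the choice of the line is periodic in [t]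
   up to boundedly many changes; hence for some [d] the second difference
   [phi_c (t) - 2 phi_c (t - d) + phi_c (t - 2 d)] vanishes outside a set of
   bounded size.  Comparing [phi_c] and [phi_c'] at the first place where they
   differ amounts to comparing these sparse sequences there, and a sparse
   sequence is coded by the positions and values of its nonzero terms. *)

Set Implicit Arguments.
Unset Strict Implicit.
Unset Printing Implicit Defensive.

Import Order.TTheory GRing.Theory Num.Theory.

(** * Quantifier elimination over the integers *)

Definition scons T (x : T) (v : nat -> T) (i : nat) : T :=
  if i is j.+1 then v j else x.
Definition tl T (v : nat -> T) : nat -> T := fun i => v i.+1.

Infix ".:" := scons (at level 60, right associativity).

Lemma scons_eta T (v : nat -> T) : v 0 .: tl v = v.
Proof. by apply: functional_extensionality => -[]. Qed.

Local Open Scope ring_scope.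

Notation env := (nat -> int).

Fixpoint dot (a : seq int) (v : env) : int :=
  if a is b :: a' then b * v 0%N + dot a' (tl v) else 0.

Definition linear_form (f : env -> int) :=
  exists a k, forall v, f v = dot a v + k.

Lemma linear_const k : linear_form (fun=> k).
Proof. by exists [::], k => v; rewrite add0r. Qed.

Lemma linear_var i : linear_form (fun v => v i).
Proof.
exists (ncons i 0 [:: 1]), 0 => v; rewrite addr0.
by elim: i v => [|i IHi] v /=; [rewrite mul1r addr0 | rewrite mul0r add0r -IHi].
Qed.

Lemma linear_add f g :
  linear_form f -> linear_form g -> linear_form (fun v => f v + g v).
Proof.
move=> [a [k fE]] [b [l gE]].
suff [c cE]: exists c, forall v, dot c v = dot a v + dot b v.
  by exists c, (k + l) => v; rewrite fE gE cE; ring.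
elim: a b {fE gE} => [|x a IHa] [|y b]; try by exists [::].
- by exists (y :: b) => v; rewrite add0r.
- by exists (x :: a) => v; rewrite addr0.
by have [c cE] := IHa b; exists (x + y :: c) => v /=; rewrite cE; ring.
Qed.

Lemma linear_scale b f : linear_form f -> linear_form (fun v => b * f v).
Proof.
move=> [a [k fE]]; exists (map ( *%R b) a), (b * k) => v; rewrite fE mulrDr.
by congr (_ + _); elim: a v {fE} => [|x a IHa] v /=; rewrite ?mulr0 // mulrDr IHa mulrA.
Qed.

Lemma linear_subst (s : nat -> env -> int) f :
  (forall i, linear_form (s i)) -> linear_form f ->
  linear_form (fun v => f (fun i => s i v)).
Proof.
move=> s_lin [a [k fE]].
suff [c [l cE]]: linear_form (fun v => dot a (fun i => s i v)).
  by exists c, (l + k) => v; rewrite fE cE; ring.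
elim: a s s_lin {fE} => [|b a IHa] s s_lin; first exact: linear_const.
by apply: linear_add; [exact: linear_scale | exact: (IHa (fun i => s i.+1))].
Qed.

(* The modulus of [QDvd d] is [d.+1], hence never zero. *)
Inductive qf :=
| QLt of seq int & int
| QDvd of nat & seq int & int
| QNot of qf
| QAnd of qf & qf.

Fixpoint qsem (v : env) (q : qf) : bool :=
  match q with
  | QLt a k => dot a v + k < 0
  | QDvd d a k => (d.+1%:Z %| dot a v + k)%Z
  | QNot p => ~~ qsem v p
  | QAnd p r => qsem v p && qsem v r
  end.

Definition QF (P : env -> Prop) := exists q, forall v, P v <-> qsem v q.

Lemma QF_qsem q : QF (fun v => qsem v q).
Proof. by exists q. Qed.

Lemma QF_ext P Q : (forall v, P v <-> Q v) -> QF Q -> QF P.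
Proof. by move=> PQ [q qE]; exists q => v; rewrite PQ. Qed.

Lemma QF_dec P : QF P -> forall v, P v \/ ~ P v.
Proof. by move=> [q qE] v; rewrite qE; case: (qsem v q); [left | right]. Qed.

Lemma QF_lt0 f : linear_form f -> QF (fun v => f v < 0).
Proof. by move=> [a [k fE]]; exists (QLt a k) => v; rewrite fE. Qed.

Lemma QF_dvd d f : linear_form f -> QF (fun v => (d.+1%:Z %| f v)%Z).
Proof. by move=> [a [k fE]]; exists (QDvd d a k) => v; rewrite fE. Qed.

Lemma QF_not P : QF P -> QF (fun v => ~ P v).
Proof. by move=> [q qE]; exists (QNot q) => v; rewrite qE; split=> /negP. Qed.

Lemma QF_and P Q : QF P -> QF Q -> QF (fun v => P v /\ Q v).
Proof.
move=> [q qE] [r rE]; exists (QAnd q r) => v /=.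
by rewrite qE rE; split=> /andP.
Qed.

Lemma QF_or P Q : QF P -> QF Q -> QF (fun v => P v \/ Q v).
Proof.
move=> hP hQ; apply: QF_ext (QF_not (QF_and (QF_not hP) (QF_not hQ))) => v.
have := QF_dec hP v; have := QF_dec hQ v; tauto.
Qed.

Lemma QF_imp P Q : QF P -> QF Q -> QF (fun v => P v -> Q v).
Proof.
move=> hP hQ; apply: QF_ext (QF_or (QF_not hP) hQ) => v.
have := QF_dec hP v; tauto.
Qed.

Lemma QF_false : QF (fun=> False).
Proof. by apply: QF_ext (QF_lt0 (linear_const 0)). Qed.

Lemma QF_seq_ex (T : eqType) (l : seq T) (P : T -> env -> Prop) :
  (forall i, i \in l -> QF (P i)) -> QF (fun v => exists2 i, i \in l & P i v).
Proof.
elim: l => [|i l IHl] Pl; first by apply: QF_ext QF_false => v; split=> // -[].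
have Pi : QF (P i) by apply: Pl; rewrite mem_head.
have {}IHl := IHl (fun j jl => Pl j (mem_behead (s := i :: l) jl)).
apply: QF_ext (QF_or Pi IHl) => v; split.
  by case=> j; rewrite inE => /predU1P[-> | jl] Pj; [left | right; exists j].
by case=> [Pi_v | [j jl Pj]]; [exists i; rewrite ?mem_head | exists j; rewrite ?inE ?jl ?orbT].
Qed.

Lemma QF_subst (s : nat -> env -> int) P :
  (forall i, linear_form (s i)) -> QF P -> QF (fun v => P (fun i => s i v)).
Proof.
move=> s_lin [q qE]; have: QF (fun v => qsem (fun i => s i v) q).
  elim: q {qE} => [a k | d a k | q IHq | q IHq r IHr] /=.
  - apply: QF_lt0; apply: (linear_subst (f := fun v => dot a v + k)) => //.
    by exists a, k.
  - apply: QF_dvd; apply: (linear_subst (f := fun v => dot a v + k)) => //.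
    by exists a, k.
  - by apply: QF_ext (QF_not IHq) => v; split=> /negP.
  - by apply: QF_ext (QF_and IHq IHr) => v; split=> /andP.
by apply: QF_ext => v; rewrite qE.
Qed.

Fixpoint modulus (q : qf) : nat :=
  match q with
  | QLt _ _ => 1
  | QDvd d _ _ => d.+1
  | QNot p => modulus p
  | QAnd p r => modulus p * modulus r
  end.

Lemma modulus_gt0 q : (0 < modulus q)%N.
Proof. by elim: q => //= q IHq r IHr; rewrite muln_gt0 IHq. Qed.

Definition near_zero (n : nat) : seq int :=
  [seq i%:Z - n%:Z | i <- iota 0 (n.*2.+1)].

Lemma mem_near_zero n (x : int) : (`|x| <= n%:Z) = (x \in near_zero n).
Proof.
apply/idP/mapP => [xn | [i]]; last by rewrite mem_iota => /andP[_ ?] ->; lia.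
by exists `|(x + n%:Z)%R|%N; rewrite ?mem_iota; lia.
Qed.

Opaque near_zero.

(* [(b, a, k)] stands for the equation [b * s + dot a v + k = 0] in [s]. *)
Notation line := (int * seq int * int)%type.

Definition on_line (L : line) (s : int) (v : env) :=
  L.1.1 != 0 /\ L.1.1 * s + dot L.1.2 v + L.2 = 0.

(** An inequality can change its truth value between [s] and [s + D] only if its form at [s] has
    absolute value at most [|b| * D]; there is one line for each such value. Divisibilities
    contribute nothing, since they are invariant under the shift once their moduli divide [D]. *)
Fixpoint critical (D : nat) (q : qf) : seq line :=
  match q with
  | QLt [::] _ => [::]
  | QLt (b :: a) k => [seq (b, a, k - j) | j <- near_zero (`|b| * D)]
  | QDvd _ _ _ => [::]
  | QNot p => critical D p
  | QAnd p r => critical D p ++ critical D r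
  end.

(* Truth is periodic in the first variable away from the critical lines. *)
Lemma qsem_shift D q s v : (modulus q %| D)%N ->
  qsem (s .: v) q <> qsem (s + D%:Z .: v) q ->
  exists2 L, L \in critical D q & on_line L s v.
Proof.
elim: q => [[|b a] k | d [|b a] k | q IHq | q IHq r IHr] //=.
- rewrite -[tl (s .: v)]/v -[tl (_ .: v)]/v => _ neq.
  have b0 : b != 0 by apply/eqP => b0; apply: neq; rewrite b0 !mul0r.
  exists (b, a, k - (b * s + dot a v + k)); last by split=> //=; ring.
  apply: (map_f (fun j => (b, a, k - j))); rewrite -mem_near_zero.
  rewrite leNgt; apply/negP => far; apply: neq; rewrite mulrDr.
  have : `|b * D%:Z| = (`|b| * D)%N :> int by rewrite normrM; lia.
  move: (b * D%:Z) (b * s) (dot a v) far => e x y; lia.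
- move=> dD []; rewrite -[tl (s .: v)]/v -[tl (_ .: v)]/v.
  have -> : b * (s + D%:Z) + dot a v + k = b * D%:Z + (b * s + dot a v + k) by ring.
  by rewrite [in RHS]rpredDl // dvdz_mull.
- by move=> qD neq; apply: IHq => // eq_q; apply: neq; rewrite eq_q.
- move=> qrD neq.
  have qD : (modulus q %| D)%N by apply: dvdn_trans qrD; rewrite dvdn_mulr.
  have rD : (modulus r %| D)%N by apply: dvdn_trans qrD; rewrite dvdn_mull.
  have [eq_q | /eqP/(IHq qD)[L Lq sL]] := eqVneq (qsem (s .: v) q) (qsem (s + D%:Z .: v) q).
    have [L Lr sL] : exists2 L, L \in critical D r & on_line L s v.
      by apply: IHr => // eq_r; apply: neq; rewrite eq_q eq_r.
    by exists L; rewrite ?mem_cat ?Lr ?orbT.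
  by exists L; rewrite ?mem_cat ?Lq.
Qed.

(** Denominators are cleared in the substitution [s = f v / b]. An inequality is multiplied by [b]
    twice, so that its sense survives a negative [b]; a divisibility has its form multiplied by [b]
    and its modulus by [|b|]. *)
Lemma qsem_at_line b f q : b != 0 -> linear_form f ->
  exists q', forall v s, b * s = f v -> qsem v q' = qsem (s .: v) q.
Proof.
move=> b0 f_lin.
have sub a k : exists a' k', forall v s, b * s = f v ->
    dot a' v + k' = b * (dot a (s .: v) + k).
  case: a => [|c a].
    by exists [::], (b * k) => v s _ /=; ring.
  have [a' [k' aE]] : linear_form (fun v => c * f v + b * (dot a v + k)).
    by apply: linear_add; apply: linear_scale => //; exists a, k.
  by exists a', k' => v s sE; rewrite -aE -sE /=; rewrite -[tl (s .: v)]/v; ring.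
have pos : 0 < b * b by rewrite -expr2 exprn_even_gt0.
elim: q => [a k | d a k | q [q' IHq] | q [q' IHq] r [r' IHr]].
- have [a' [k' aE]] := sub a k.
  have [a2 [k2 a2E]] : linear_form (fun v => b * (dot a' v + k')).
    by apply: linear_scale; exists a', k'.
  exists (QLt a2 k2) => v s sE /=; rewrite -a2E (aE v s sE) mulrA.
  by rewrite pmulr_rlt0.
- have [a' [k' aE]] := sub a k.
  exists (QDvd (`|b| * d.+1).-1 a' k') => v s sE /=; rewrite (aE v s sE).
  rewrite prednK; last by rewrite muln_gt0 absz_gt0 b0.
  by rewrite !dvdzE /= abszM dvdn_pmul2l // absz_gt0.
- by exists (QNot q') => v s sE /=; rewrite (IHq v s sE).
- by exists (QAnd q' r') => v s sE /=; rewrite (IHq v s sE) (IHr v s sE).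
Qed.

(** For large [s] an inequality that involves [s] is decided by the sign of the coefficient of [s],
    and within one residue class modulo [D] a divisibility does not depend on [s]. *)
Lemma qsem_at_infinity D q (r : int) : (modulus q %| D)%N ->
  exists q', forall v, exists B, forall s, B <= s -> (D%:Z %| s - r)%Z ->
    qsem v q' = qsem (s .: v) q.
Proof.
elim: q => [[|b a] k | d [|b a] k | q IHq | q IHq p IHp] /= qD.
- by exists (QLt [::] k) => v; exists 0.
- have [b0 | b0 | b0] := ltgtP b 0.
  (* [QLt [::] (-1)] is a formula for truth and [QLt [::] 1], used next, one for falsity. *)
  + exists (QLt [::] (-1)) => v; exists (`|dot a v + k| + 1) => s sB _ /=.
    rewrite -[tl (s .: v)]/v; symmetry; rewrite add0r.
    have : b * s <= - s
      by rewrite -subr_ge0 (_ : - s - b * s = (- b - 1) * s); [apply: mulr_ge0; lia | ring].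
    move: (b * s) (dot a v) sB => *; lia.
  + exists (QLt [::] 1) => v; exists (`|dot a v + k| + 1) => s sB _ /=.
    rewrite -[tl (s .: v)]/v; symmetry; rewrite add0r.
    have : s <= b * s
      by rewrite -subr_ge0 (_ : b * s - s = (b - 1) * s); [apply: mulr_ge0; lia | ring].
    move: (b * s) (dot a v) sB => *; lia.
  + exists (QLt a k) => v; exists 0 => s _ _ /=.
    by rewrite b0 mul0r add0r.
- by exists (QDvd d [::] k) => v; exists 0.
- exists (QDvd d a (b * r + k)) => v; exists 0 => s _ sr /=; rewrite -[tl (s .: v)]/v.
  have -> : b * s + dot a v + k = b * (s - r) + (dot a v + (b * r + k)) by ring.
  rewrite [in RHS]rpredDl // dvdz_mull //; apply: dvdz_trans sr; exact: qD.
- have [q' q'E] := IHq qD; exists (QNot q') => v.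
  by have [B BE] := q'E v; exists B => s sB sr /=; rewrite (BE s).
- have [|q' q'E] := IHq; first by apply: dvdn_trans qD; rewrite dvdn_mulr.
  have [|p' p'E] := IHp; first by apply: dvdn_trans qD; rewrite dvdn_mull.
  exists (QAnd q' p') => v; have [B BE] := q'E v; have [C CE] := p'E v.
  by exists (Num.max B C) => s; rewrite ge_max => /andP[sB sC] sr /=; rewrite (BE s) // (CE s).
Qed.

(** If some witness lies on a critical line, solving that line for [s] finds it. If none does, a
    witness stays one under repeated shifts by [D], so the formula holds far out in one of the [D]
    residue classes. This leaves finitely many quantifier-free cases. *)
Lemma QF_ex P : QF P -> QF (fun v => exists x, P (x .: v)).
Proof.
move=> [q qE]; pose D := modulus q; have D0 : (0 < D)%N := modulus_gt0 q.
have shift s v : qsem (s .: v) q <> qsem (s + D%:Z .: v) q ->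
  exists2 L, L \in critical D q & on_line L s v by exact: qsem_shift.
pose at_line (L : line) v := exists s, on_line L s v /\ qsem (s .: v) q.
have at_lineQ L : QF (at_line L).
  case: L => [[b a] k]; have [b0 | b0] := eqVneq b 0.
    by apply: QF_ext QF_false => v; split=> // -[s [[]]]; rewrite b0.
  have f_lin : linear_form (fun v => - 1 * (dot a v + k)).
    by apply: linear_scale; exists a, k.
  have [q' q'E] := qsem_at_line q b0 f_lin.
  have bP : (absz b).-1.+1 = absz b by rewrite prednK ?absz_gt0.
  (* The line has an integer point exactly when [b] divides the value of the form; the predecessor
     offsets the successor in the modulus of [QDvd]. *)
  apply: QF_ext (QF_and (QF_dvd (absz b).-1 f_lin) (QF_qsem q')) => v.
  rewrite bP; split.
    move=> [s [[/= _ sL] qs]]; have sE : b * s = - 1 * (dot a v + k) by lia.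
    by rewrite (q'E v s sE) qs -sE dvdzE /= abszM dvdn_mulr.
  rewrite dvdzE absz_id -dvdzE => -[/dvdzP[s sE]].
  symmetry in sE; rewrite mulrC in sE.
  by rewrite (q'E v s sE) => qs; exists s; split=> //; split=> //=; lia.
have [w wE] : exists w : nat -> qf, forall r v, exists B, forall s, B <= s ->
    (D%:Z %| s - r%:Z)%Z -> qsem v (w r) = qsem (s .: v) q.
  have W (r : nat) := @qsem_at_infinity D q r%:Z (dvdnn _).
  exists (fun r => proj1_sig (constructive_indefinite_description _ (W r))) => r.
  exact: (proj2_sig (constructive_indefinite_description _ (W r))).
have QF1 := @QF_seq_ex _ (critical D q) at_line (fun L _ => at_lineQ L).
have QF2 := @QF_seq_ex _ (iota 0 D) (fun r v => qsem v (w r))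
  (fun r _ => QF_qsem (w r)).
apply: QF_ext (QF_or QF1 QF2) => v; split; last first.
  case=> [[L _ [s [_ qs]]] | [r _ qr]]; first by exists s; apply/qE.
  (* The witness is a number in the class of [r] modulo [D] that is at least [B]. *)
  have [B BE] := wE r v; exists (r%:Z + `|B| * D%:Z); apply/qE.
  rewrite -(BE _ _ _) //; first by rewrite ler_wpDl // (le_trans (ler_norm _)) // ler_peMr //; lia.
  by rewrite addrC addKr dvdz_mull.
move=> [s /qE qs].
have [|noline] := excluded_middle_informative (exists2 L, L \in critical D q & at_line L v).
  by left.
right.
have all_j (j : nat) : qsem (s + j%:Z * D%:Z .: v) q.
  elim: j => [|j IHj]; first by rewrite mul0r addr0.
  have -> : s + j.+1%:Z * D%:Z = s + j%:Z * D%:Z + D%:Z by rewrite -addn1 PoszD; ring.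
  apply/negPn/negP => nq; apply: noline.
  have [|L Lq sL] := shift (s + j%:Z * D%:Z) v; first by rewrite IHj (negbTE nq).
  by exists L => //; exists (s + j%:Z * D%:Z).
have D0' : D%:Z != 0 by lia.
exists `|(s %% D%:Z)%Z|%N.
  by rewrite mem_iota /=; have := ltz_pmod s (d := D%:Z); have := modz_ge0 s D0'; lia.
have [B BE] := wE `|(s %% D%:Z)%Z|%N v; rewrite (BE (s + (`|B| + `|s|)%N%:Z * D%:Z)) //.
  have : (`|B| + `|s|)%N%:Z <= (`|B| + `|s|)%N%:Z * D%:Z by rewrite ler_peMr //; lia.
  lia.
rewrite gez0_abs ?modz_ge0 // {1}(divz_eq s D%:Z).
rewrite (_ : _ - _ = ((s %/ D)%Z + (`|B| + `|s|)%N%:Z) * D%:Z); last by ring.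
by rewrite dvdz_mull.
Qed.

Lemma QF_all P : QF P -> QF (fun v => forall x, P (x .: v)).
Proof.
move=> hP; apply: QF_ext (QF_not (QF_ex (QF_not hP))) => v; split.
  by move=> Pv [x]; apply.
by move=> nP x; case: (QF_dec hP (x .: v)) => // nPx; case: nP; exists x.
Qed.

Lemma linear_tl f : linear_form f -> linear_form (fun v => f (tl v)).
Proof. by apply: linear_subst => i; exact: linear_var. Qed.

Lemma QF_eq0 f : linear_form f -> QF (fun v => f v = 0).
Proof.
move=> f_lin; have Nf_lin := linear_scale (-1) f_lin.
by apply: QF_ext (QF_not (QF_or (QF_lt0 f_lin) (QF_lt0 Nf_lin))) => v; lia.
Qed.

(** * Functions with a quantifier-free definable graph *)

Definition DF (f : env -> int) := QF (fun v => v 0%N = f (tl v)).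

Lemma DF_ext f g : f =1 g -> DF f -> DF g.
Proof. by move=> fg; apply: QF_ext => v; rewrite fg. Qed.

Lemma QF_let f P : DF f -> QF P -> QF (fun v => P (f v .: v)).
Proof.
move=> hf hP; apply: QF_ext (QF_ex (QF_and hf hP)) => v; split.
  by move=> Pf; exists (f v).
by case=> y [/= ->].
Qed.

Lemma DF_linear f : linear_form f -> DF f.
Proof.
move=> f_lin; have := linear_add (linear_var 0) (linear_scale (-1) (linear_tl f_lin)).
by move=> /QF_eq0; apply: QF_ext => v; lia.
Qed.

Lemma DF_subst (s : nat -> env -> int) f :
  (forall i, linear_form (s i)) -> DF f -> DF (fun v => f (fun i => s i v)).
Proof.
move=> s_lin hf.
apply: (QF_subst (s := fun i => if i is j.+1 then fun v => s j (tl v) else fun v => v 0%N) _ hf).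
by case=> [|i]; [exact: linear_var | exact: linear_tl].
Qed.

Lemma DF_tl f : DF f -> DF (fun v => f (tl v)).
Proof. by apply: DF_subst => i; exact: linear_var. Qed.

Lemma DF_comp f g : DF f -> DF g -> DF (fun v => f (g v .: v)).
Proof.
move=> hf hg; apply: (QF_let (P := fun w => w 1%N = f (w 0%N .: tl (tl w))) (DF_tl hg)).
apply: (QF_subst
  (s := fun i => if i is j.+1 then fun v => (v 0%N .: tl (tl v)) j else fun v => v 1%N) _ hf).
by case=> [|[|i]]; exact: linear_var.
Qed.

Lemma QF_lt f g : DF f -> DF g -> QF (fun v => f v < g v).
Proof.
move=> hf hg; apply: (QF_let (P := fun w => w 0%N < g (tl w)) hf).
apply: (QF_let (P := fun w => w 1%N < w 0%N) (DF_tl hg)).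
have := QF_lt0 (linear_add (linear_var 1) (linear_scale (-1) (linear_var 0))).
by apply: QF_ext => v; lia.
Qed.

Lemma QF_eq f g : DF f -> DF g -> QF (fun v => f v = g v).
Proof.
by move=> hf hg; apply: QF_ext (QF_not (QF_or (QF_lt hf hg) (QF_lt hg hf))) => v; lia.
Qed.

Lemma DF_add f g : DF f -> DF g -> DF (fun v => f v + g v).
Proof.
move=> hf hg; apply: (DF_comp (f := fun w => w 0%N + g (tl w))) hf.
apply: (DF_comp (f := fun w => w 1%N + w 0%N) _ (DF_tl hg)).
by apply: DF_linear; apply: linear_add; exact: linear_var.
Qed.

Lemma DF_scale b f : DF f -> DF (fun v => b * f v).
Proof.
apply: (DF_comp (f := fun w => b * w 0%N)).
by apply: DF_linear; apply: linear_scale; exact: linear_var.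
Qed.

Lemma DF_if P f g h : QF P -> DF f -> DF g ->
  (forall v, P v -> h v = f v) -> (forall v, ~ P v -> h v = g v) -> DF h.
Proof.
move=> hP hf hg hfE hgE.
have hP' : QF (fun v => P (tl v)).
  by apply: (QF_subst (s := fun i v => tl v i)) hP => i; exact: linear_var.
apply: QF_ext (QF_or (QF_and hP' hf) (QF_and (QF_not hP') hg)) => v.
by case: (QF_dec hP (tl v)) => Pv; [rewrite (hfE _ Pv) | rewrite (hgE _ Pv)]; tauto.
Qed.

Lemma DF_if_pos f g h : DF f -> DF g -> DF h ->
  DF (fun v => if 0 < f v then g v else h v).
Proof.
move=> hf hg hh; have h0 := QF_lt (DF_linear (linear_const 0)) hf.
by apply: (DF_if h0 hg hh) => v; [move=> -> | move/negP/negbTE ->].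
Qed.

(** * Second differences of definable functions are sparse *)

(** A change puts [t] on a critical line, and each critical line determines [t] by exact division;
    so the number of changes is bounded independently of [c]. *)
Lemma QF_changes P : QF P -> exists2 d0 : nat, (0 < d0)%N &
  forall d : nat, (d0 %| d)%N -> exists K : nat, forall c, exists2 l : seq int,
    (size l <= K)%N & forall t, ~ (P (t .: c) <-> P (t + d%:Z .: c)) -> t \in l.
Proof.
move=> [q qE]; exists (modulus q); first exact: modulus_gt0.
move=> d qd; exists (size (critical d q)) => c.
exists [seq (- (dot L.1.2 c + L.2) %/ L.1.1)%Z | L <- critical d q].
  by rewrite size_map.
move=> t change; have [|L Lq [L0 Lt]] := @qsem_shift d q t c qd.
  by move=> eq_q; apply: change; rewrite !qE eq_q.
apply/mapP; exists L => //; rewrite (_ : - _ = t * L.1.1) ?mulzK //.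
by rewrite -[in LHS](addrK (L.1.1 * t) (_ + _)) [_ + _ * t]addrC addrA Lt; ring.
Qed.

Definition second_diff (d : nat) (phi : env -> int) (c : env) (t : int) : int :=
  phi (t .: c) + (- 2 * phi (t - d%:Z .: c) + phi (t - d%:Z - d%:Z .: c)).

Lemma dot_second_diff a d c t : second_diff d (dot a) c t = 0.
Proof. by case: a => [|b a] //; rewrite /second_diff /= -![tl (_ .: c)]/c; ring. Qed.

(** If the points of the graph at [t], [t - d] and [t - 2 d] lie on one line, the second difference
    at [t] vanishes. Hence, when the point at [t] lies on [L], it can be nonzero only if lying on
    [L] changes between [t - d] and [t] or between [t - 2 d] and [t - d], and [QF_changes] bounds
    the number of such [t]. *)
Lemma second_diff_on_lines phi (Ls : seq line) : DF phi ->
  exists2 d0 : nat, (0 < d0)%N & forall d : nat, (d0 %| d)%N ->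
  exists K : nat, forall c, exists2 l : seq int, (size l <= K)%N &
  forall t L, L \in Ls -> on_line L (phi (t .: c)) (t .: c) ->
    second_diff d phi c t != 0 -> t \in l.
Proof.
move=> hphi; elim: Ls => [|L Ls [d1 d1_gt0 IHLs]].
  by exists 1%N => // d _; exists 0%N => c; exists [::].
pose P v := on_line L (phi v) v.
have hP : QF P.
  case: L @P => -[b a k]; rewrite /on_line /=; have [b0 | b0] := eqVneq b 0.
    by apply: QF_ext QF_false => v; split=> // -[].
  have hf : DF (fun v => b * phi v + (dot a v + k)).
    by apply: DF_add; [exact: DF_scale | apply: DF_linear; exists a, k].
  apply: QF_ext (QF_eq hf (DF_linear (linear_const 0))) => v.
  by rewrite addrA; split=> [[]|].
have [d2 d2_gt0 Pd] := QF_changes hP.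
exists (d1 * d2)%N => [|d d12]; first by rewrite muln_gt0 d1_gt0.
have [K1 IH] := IHLs d (dvdn_trans (dvdn_mulr _ (dvdnn _)) d12).
have [K2 Ch] := Pd d (dvdn_trans (dvdn_mull _ (dvdnn _)) d12).
exists (K1 + K2.*2)%N => c; have [l1 l1K l1E] := IH c; have [l2 l2K l2E] := Ch c.
exists (l1 ++ [seq t + d%:Z | t <- l2] ++ [seq t + d%:Z + d%:Z | t <- l2]).
  by rewrite !size_cat !size_map addnn leq_add // leq_double.
move=> t L'; rewrite !mem_cat inE => /predU1P[-> Pt nz | L's L't nz]; last first.
  by rewrite (l1E t L').
have [Pt1 | nPt1] := QF_dec hP (t - d%:Z .: c); last first.
  rewrite (_ : t \in map _ _) ?orbT //; apply/mapP; exists (t - d%:Z); last by ring.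
  by apply: l2E; rewrite subrK; move: Pt; rewrite -/(P _); tauto.
have [Pt2 | nPt2] := QF_dec hP (t - d%:Z - d%:Z .: c); last first.
  rewrite [X in _ || (_ || X)](_ : _ = true) ?orbT //; apply/mapP.
  exists (t - d%:Z - d%:Z); last by ring.
  by apply: l2E; rewrite subrK; tauto.
(* All three points lie on the line, so [L.1.1] times the second difference of [phi] is minus that
   of [dot L.1.2], which is zero. *)
case/negP: nz; case: Pt Pt1 Pt2 => L0 Pt [_ Pt1] [_ Pt2].
rewrite -(mulrI_eq0 _ (mulfI L0)); apply/eqP.
have := dot_second_diff L.1.2 d c t; rewrite /second_diff.
by move: (dot _ _) (dot _ _) (dot _ _) Pt Pt1 Pt2 => x y z; lia.
Qed.

(** The formula of the graph is true at the value [phi (t .: c)] and false at that value plus its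
    modulus. By [qsem_shift], applied to the variable of the value, every point of the graph lies on
    one of finitely many lines. *)
Lemma second_diff_sparse phi : DF phi ->
  exists2 d : nat, (0 < d)%N & exists K : nat, forall c,
  exists2 l : seq int, (size l <= K)%N &
  forall t, second_diff d phi c t != 0 -> t \in l.
Proof.
move=> hphi; have [q qE] := hphi.
have [d0 d0_gt0 lines] := second_diff_on_lines (critical (modulus q) q) hphi.
have [K KE] := lines d0 (dvdnn _); exists d0 => //; exists K => c.
have [l lK lE] := KE c; exists l => // t nz.
have [eq_q | L Ls Lt] := @qsem_shift _ q (phi (t .: c)) (t .: c) (dvdnn _);
  last exact: lE _ _ Ls Lt nz.
have /qE : qsem (phi (t .: c) + (modulus q)%:Z .: t .: c) q by rewrite -eq_q; apply/qE.
by rewrite /= -[tl (_ .: t .: c)]/(t .: c); have := modulus_gt0 q; lia.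
Qed.

(** * Monotone codes *)

Lemma DF_choice P : QF P -> (forall c, exists y, P (y .: c)) ->
  (forall c y z, P (y .: c) -> P (z .: c) -> y = z) ->
  exists2 f, DF f & forall c, P (f c .: c).
Proof.
move=> hP ex uniq.
pose f c := proj1_sig (constructive_indefinite_description _ (ex c)).
have fP c : P (f c .: c) := proj2_sig (constructive_indefinite_description _ (ex c)).
exists f => //; apply: QF_ext hP => v; split=> [v0 | Pv].
  by rewrite -(scons_eta v) v0.
by apply: uniq (fP _); rewrite scons_eta.
Qed.

Fixpoint lex_lt T (lt : T -> T -> Prop) (fs : seq ((nat -> T) -> T))
    (c c' : nat -> T) : Prop :=
  if fs is f :: fs' then
    lt (f c) (f c') \/ (f c = f c' /\ lex_lt lt fs' c c')
  else False.

Fixpoint agree T (fs : seq ((nat -> T) -> T)) (c c' : nat -> T) : Prop :=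
  if fs is f :: fs' then f c = f c' /\ agree fs' c c' else True.

Notation lex_ltZ := (lex_lt (fun x y : int => x < y)).

Lemma lex_lt_cat T (lt : T -> T -> Prop) fs gs c c' :
  lex_lt lt (fs ++ gs) c c' <->
  lex_lt lt fs c c' \/ (agree fs c c' /\ lex_lt lt gs c c').
Proof. elim: fs => [|f fs IHfs] /=; [tauto | rewrite IHfs; tauto]. Qed.

Lemma agree_cat T (fs gs : seq ((nat -> T) -> T)) c c' :
  agree (fs ++ gs) c c' <-> agree fs c c' /\ agree gs c c'.
Proof. elim: fs => [|f fs IHfs] /=; [tauto | rewrite IHfs; tauto]. Qed.

Fixpoint DFs (fs : seq (env -> int)) : Prop :=
  if fs is f :: fs' then DF f /\ DFs fs' else True.

Lemma DFs_cat fs gs : DFs fs -> DFs gs -> DFs (fs ++ gs).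
Proof. by elim: fs => [|f fs IHfs] //= [? ?] ?; split=> //; exact: IHfs. Qed.

(* The second disjunct fixes a junk value for the zero function. *)
Definition first_nonzero (g : int -> int) (u : int) :=
  (g u <> 0 /\ forall t, t < u -> g t = 0) \/ (u = 0 /\ forall t, g t = 0).

Lemma first_nonzero_uniq g u u' :
  first_nonzero g u -> first_nonzero g u' -> u = u'.
Proof.
move=> [[gu u_min] | [u0 g0]] [[gu' u_min'] | [u0' g0']]; last by rewrite u0.
- have [lt_u | lt_u | //] := ltgtP u u'; first by case: gu; rewrite u_min'.
  by case: gu'; rewrite u_min.
- by case: gu.
- by case: gu'.
Qed.

Lemma int_least (P : int -> Prop) t : (forall s, s < 0 -> ~ P s) -> P t ->
  exists2 u, P u & forall s, s < u -> ~ P s.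
Proof.
move=> Pneg Pt; have t0 : 0 <= t by rewrite leNgt; apply/negP => /Pneg.
pose p (n : nat) : bool := excluded_middle_informative (P n%:Z).
have pP n : p n <-> P n%:Z by rewrite /p; case: excluded_middle_informative.
have exp : exists n, p n by exists `|t|%N; apply/pP; rewrite gez0_abs.
case: (ex_minnP exp) => n /pP Pn n_min; exists n%:Z => // s sn Ps.
have [/Pneg // | s0] := ltP s 0.
have : (n <= `|s|)%N by apply/n_min/pP; rewrite gez0_abs.
by lia.
Qed.

Lemma first_nonzero_ex g : (forall t, t < 0 -> g t = 0) -> exists u, first_nonzero g u.
Proof.
move=> gneg; have [[t gt] | g0] := excluded_middle_informative (exists t, g t <> 0).
  have [|u gu u_min] := @int_least (fun s => g s <> 0) t _ gt.
    by move=> s /gneg ->.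
  by exists u; left; split=> // s /u_min; have [-> | /eqP] := eqVneq (g s) 0.
exists 0; right; split=> // t; have [// | /eqP gt] := eqVneq (g t) 0.
by case: g0; exists t.
Qed.

(* The code lists the nonzero values in increasing order of their positions:
   one at [u] contributes its sign [s], the position as [- s * u] and itself.
   A positive entry makes a function larger the earlier it occurs, a negative
   one makes it smaller. *)
Lemma sparse_code K psi : DF psi ->
  (forall c t, t < 0 -> psi (t .: c) = 0) ->
  (forall c, exists2 l : seq int, (size l <= K)%N &
     forall t, psi (t .: c) <> 0 -> t \in l) ->
  exists2 fs, DFs fs & forall c c',
    ((forall t, psi (t .: c) = psi (t .: c')) -> agree fs c c') /\
    (forall T, (forall t, t < T -> psi (t .: c) = psi (t .: c')) ->
       psi (T .: c) < psi (T .: c') -> lex_ltZ fs c c').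
Proof.
elim: K psi => [|K IHK] psi hpsi psi_neg sparse.
  exists [::] => // c c'; split=> // T _; suff z e : psi (T .: e) = 0 by rewrite !z.
  have [[|//] _ lE] := sparse e; have [// | /eqP/lE //] := eqVneq (psi (T .: e)) 0.
have zeroF : DF (fun=> 0) by apply/DF_linear/linear_const.
have [u hu uP] : exists2 u, DF u &
    forall c, first_nonzero (fun t => psi (t .: c)) (u c).
  apply: (DF_choice (P := fun v =>
      (psi v <> 0 /\ forall t, t < v 0%N -> psi (t .: tl v) = 0) \/
      (v 0%N = 0 /\ forall t, psi (t .: tl v) = 0))).
  - have psi2 : DF (fun w => psi (w 0%N .: tl (tl w))).
      apply: (DF_subst (s := fun i w => (w 0%N .: tl (tl w)) i)) hpsi.
      by case=> [|i]; exact: linear_var.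
    apply: QF_or; apply: QF_and.
    + by apply/QF_not/QF_eq.
    + apply: (QF_all (P := fun w => w 0%N < w 1%N -> psi (w 0%N .: tl (tl w)) = 0)).
      apply: QF_imp; last exact: QF_eq.
      by apply: QF_lt; apply/DF_linear/linear_var.
    + by apply: QF_eq0; exact: linear_var.
    + by apply: (QF_all (P := fun w => psi (w 0%N .: tl (tl w)) = 0)); exact: QF_eq.
  - by move=> c; apply: first_nonzero_ex => t; exact: psi_neg.
  - by move=> c y z; exact: (@first_nonzero_uniq (fun t => psi (t .: c))).
pose w c := psi (u c .: c).
have hw : DF w by exact: DF_comp.
have constF k : DF (fun=> k) by apply/DF_linear/linear_const.
pose by_sign (x y z : int) (c : env) :=
  if 0 < w c then x else if 0 < - 1 * w c then y else z.
pose s c := by_sign 1 (- 1) 0 c.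
pose e c := by_sign (- 1 * u c) (u c) 0 c.
have hs : DF s by do 2!apply: DF_if_pos => //; exact: DF_scale.
have he : DF e by apply: DF_if_pos => //; [|apply: DF_if_pos => //]; exact: DF_scale.
(* [rest] is [psi] with the entry at [u] erased; the test for equality with [u] is written as two
   sign tests to fit [DF_if_pos]. *)
pose rest v := if 0 < v 0%N + - 1 * u (tl v) then psi v else
  if 0 < u (tl v) + - 1 * v 0%N then psi v else 0.
have hrest : DF rest.
  have v0 : DF (fun v => v 0%N) by apply/DF_linear/linear_var.
  have hu1 : DF (fun v => u (tl v)) by exact: DF_tl.
  have hd f g : DF f -> DF g -> DF (fun v => f v + -1 * g v).
    by move=> hf hg; apply: DF_add => //; exact: DF_scale.
  by apply: DF_if_pos; [exact: hd | | apply: DF_if_pos => //; exact: hd].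
have restE t c : rest (t .: c) = if t == u c then 0 else psi (t .: c).
  rewrite /rest /= -[tl (t .: c)]/c; case: eqP => [-> | ne].
    by rewrite mulN1r subrr ltxx.
  by case: ifP => // ?; case: ifP => //; lia.
have [|c|fs hfs fsE] := IHK rest hrest.
- by move=> c t t0; rewrite restE psi_neg // if_same.
(* Deleting [u c] from the list makes it shorter. If [u c] is not in the list, [psi] vanishes at [c]
   altogether and the empty list serves. *)
- have [l lK lE] := sparse c.
  have [u_l | u_l] := boolP (u c \in l).
    exists [seq t <- l | t != u c].
      rewrite size_filter -ltnS; apply: leq_trans lK.
      rewrite -(count_predC (pred1 (u c)) l) -add1n leq_add2r -has_count.
      by apply/hasP; exists (u c) => /=.
    by move=> t; rewrite restE mem_filter; case: eqP => // _; exact: lE.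
  exists [::] => // t; rewrite restE; case: (uP c) => [[/lE] | [_ -> ]]; last by rewrite if_same.
  by rewrite (negbTE u_l).
exists [:: s, e, w & fs] => [|c c']; first by do 3!split=> //.
have [fs_eq fs_lt] := fsE c c'.
have same_u : (u c = u c' /\ w c = w c') -> s c = s c' /\ e c = e c' /\ w c = w c'.
  by case=> uE wE; rewrite /s /e /by_sign uE wE.
split=> [psiE | T below at_T].
  have uE : u c = u c'.
    have psi_ext : (fun t => psi (t .: c)) = (fun t => psi (t .: c')).
      exact: functional_extensionality.
    by apply: first_nonzero_uniq (uP c) _; rewrite psi_ext.
  have wE : w c = w c' by rewrite /w uE psiE.
  have [sE [eE _]] := same_u (conj uE wE); do 3!split=> //; apply: fs_eq => t.
  by rewrite !restE uE psiE.
(* If a nonzero entry precedes [T], the two first entries coincide and the comparison is left to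
   [rest]. Otherwise both functions vanish before [T], and their first entries decide. *)
have [[t [tT psi_t]] | zero] :=
    excluded_middle_informative (exists t, t < T /\ psi (t .: c) <> 0).
  have [psi_u u_min] : psi (u c .: c) <> 0 /\ forall t, t < u c -> psi (t .: c) = 0.
    by case: (uP c) => // -[_ psi0]; case: psi_t; apply: psi0.
  have uT : u c < T by apply: le_lt_trans tT; rewrite leNgt; apply/negP => /u_min.
  have uE : u c = u c'.
    apply: first_nonzero_uniq (uP c'); left; rewrite -below //.
    by split=> // t' t'u; rewrite -below ?u_min // (lt_trans t'u).
  have wE : w c = w c' by rewrite /w -uE below.
  have [sE [eE _]] := same_u (conj uE wE); do 3!(right; split=> //).
  apply: (fs_lt T) => [t' t'T|]; rewrite !restE -uE; first by case: ifP; rewrite // below.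
  by rewrite gt_eqF.
have head b : (forall t, t < T -> psi (t .: b) = 0) ->
    (psi (T .: b) <> 0 /\ u b = T /\ w b = psi (T .: b)) \/
    (psi (T .: b) = 0 /\ (w b = 0 \/ T < u b)).
  move=> b0; rewrite /w; case: (uP b) => [[psi_u u_min] | [_ psi0]].
  2: by right; split; [exact: psi0 | left; exact: psi0].
  have [uT | uT | uT] := ltgtP (u b) T; first by case: psi_u; apply: b0.
  - by right; split; [apply: u_min | right].
  - by left; rewrite -uT.
have zero_c t : t < T -> psi (t .: c) = 0.
  by move=> tT; have [// | /eqP nz] := eqVneq (psi (t .: c)) 0; case: zero; exists t.
have := head c zero_c; have := head c' (fun t tT => etrans (esym (below t tT)) (zero_c t tT)).
rewrite /= /s /e /by_sign; move: at_T; move: (psi (T .: c)) (psi (T .: c')) => x x'.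
move: (w c) (w c') (u c) (u c') => y y' z z'.
(* The smaller value at [T] is negative or the larger one is positive. The first entries then differ
   in sign, or else in position, or else in value, and each time in the right direction. *)
case: (ltP 0 y); case: (ltP 0 (-1 * y)); case: (ltP 0 y'); case: (ltP 0 (-1 * y')) => *; lia.
Qed.

(* The second differences of [phi] are sparse, and the first place where two
   functions differ is also the first place where their second differences do. *)
Lemma half_line_code phi : DF phi ->
  (forall c t, t < 0 -> phi (t .: c) = 0) ->
  exists2 fs, DFs fs & forall c c',
    ((forall t, phi (t .: c) = phi (t .: c')) -> agree fs c c') /\
    ((forall t, phi (t .: c) <= phi (t .: c')) ->
     (exists t, phi (t .: c) < phi (t .: c')) -> lex_ltZ fs c c').
Proof.
move=> hphi phi_neg; have [d d_gt0 [K sparse]] := second_diff_sparse hphi.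
pose psi v := second_diff d phi (tl v) (v 0%N).
have hshift (k : int) : DF (fun v => phi (v 0%N + k .: tl v)).
  apply: (DF_subst (s := fun i v => (v 0%N + k .: tl v) i)) hphi.
  case=> [|i] /=; last exact: linear_var.
  by apply: linear_add; [exact: linear_var | exact: linear_const].
have hpsi : DF psi.
  have h0 : DF (fun v => phi (v 0%N .: tl v)).
    by apply: DF_ext hphi => v; rewrite scons_eta.
  have h2 : DF (fun v => phi (v 0%N - d%:Z - d%:Z .: tl v)).
    by apply: DF_ext (hshift (- d%:Z - d%:Z)) => v; rewrite addrA.
  by apply: DF_add => //; apply: DF_add => //; apply: DF_scale; exact: hshift.
have [|c|fs hfs fsE] := sparse_code (K := K) hpsi.
- by move=> c t t0; rewrite /psi /second_diff !phi_neg //=; lia.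
- have [l lK lE] := sparse c; exists l => // t /eqP; exact: lE.
exists fs => // c c'; have [fs_eq fs_lt] := fsE c c'; split=> [phiE | phi_le [t0 lt_t0]].
  by apply: fs_eq => t; rewrite /psi /second_diff -![tl (_ .: _)]/(_ : env) !phiE.
have [|T lt_T T_min] := @int_least (fun t => phi (t .: c) < phi (t .: c')) t0 _ lt_t0.
  by move=> t t_lt0; rewrite !phi_neg.
have below t : t < T -> phi (t .: c) = phi (t .: c').
  by move=> /T_min/negP; rewrite -leNgt => ?; apply/eqP; rewrite eq_le phi_le.
apply: (fs_lt T) => [t tT|].
  rewrite /psi /second_diff -[tl (_ .: c)]/c -[tl (_ .: c')]/c' /=.
  by rewrite !below //; lia.
(* At the least [T] with strict inequality the terms at [T - d] and [T - 2 d] are equal and cancel,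
   so the second differences compare as the values do. *)
rewrite /psi /second_diff -[tl (_ .: c)]/c -[tl (_ .: c')]/c' /=.
by rewrite !(below (T - _)) ?(below (T - _ - _)) ?ltrD2r //; lia.
Qed.

(** A first place of difference need not exist on the whole line, so [phi] is split at zero and its
    left half reflected. The code of the left half comes second and matters only when the right
    halves are equal. *)
Lemma line_code phi : DF phi ->
  exists2 fs, DFs fs & forall c c',
    ((forall t, phi (t .: c) = phi (t .: c')) -> agree fs c c') /\
    ((forall t, phi (t .: c) <= phi (t .: c')) ->
     (exists t, phi (t .: c) < phi (t .: c')) -> lex_ltZ fs c c').
Proof.
move=> hphi.
have hsign : DF (fun v => v 0%N + 1).
  by apply: DF_linear; apply: linear_add; [exact: linear_var | exact: linear_const].
have zeroF : DF (fun=> 0) by apply/DF_linear/linear_const.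
pose pos v := if 0 < v 0%N + 1 then phi v else 0.
pose neg v := if 0 < v 0%N + 1 then phi (-1 * v 0%N .: tl v) else 0.
have hpos : DF pos by exact: DF_if_pos.
have hneg : DF neg.
  apply: DF_if_pos => //.
  apply: (DF_subst (s := fun i v => (-1 * v 0%N .: tl v) i)) hphi.
  by case=> [|i] /=; [apply: linear_scale|]; exact: linear_var.
have [|fs hfs fsE] := half_line_code hpos.
  by move=> c t t0; rewrite /pos /=; case: ltP => //; lia.
have [|gs hgs gsE] := half_line_code hneg.
  by move=> c t t0; rewrite /neg /=; case: ltP => //; lia.
exists (fs ++ gs); first exact: DFs_cat.
move=> c c'; have [fs_eq fs_lt] := fsE c c'; have [gs_eq gs_lt] := gsE c c'.
have posE t e : pos (t .: e) = if 0 < t + 1 then phi (t .: e) else 0 by [].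
have negE t e : neg (t .: e) = if 0 < t + 1 then phi (-1 * t .: e) else 0 by [].
split=> [phiE | phi_le [t lt_t]].
  by apply/agree_cat; split; [apply: fs_eq | apply: gs_eq] => t; rewrite ?posE ?negE phiE.
have pos_le s : pos (s .: c) <= pos (s .: c') by rewrite !posE; case: ifP.
have neg_le s : neg (s .: c) <= neg (s .: c') by rewrite !negE; case: ifP.
apply/lex_lt_cat.
have [pos_lt | pos_nlt] := excluded_middle_informative (exists s, pos (s .: c) < pos (s .: c')).
  by left; exact: fs_lt.
right; split.
  apply: fs_eq => s; apply/eqP; rewrite eq_le pos_le leNgt; apply/negP => lt_s.
  by apply: pos_nlt; exists s.
apply: gs_lt => //; exists (-1 * t); rewrite !negE mulrA mulrNN !mul1r.
case: (ltP 0 (-1 * t + 1)) => // t_gt0; case: pos_nlt; exists t; rewrite !posE.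
by case: (ltP 0 (t + 1)) => //; lia.
Qed.

(** Lexicographic comparability at every [t] makes the first coordinates comparable pointwise. If
    they differ somewhere, their code decides; if they agree everywhere, the hypotheses pass to the
    remaining coordinates. *)
Lemma lines_code gs : DFs gs ->
  exists2 fs, DFs fs & forall c c',
    ((forall t, agree gs (t .: c) (t .: c')) -> agree fs c c') /\
    ((forall t, agree gs (t .: c) (t .: c') \/ lex_ltZ gs (t .: c) (t .: c')) ->
     (exists t, lex_ltZ gs (t .: c) (t .: c')) -> lex_ltZ fs c c').
Proof.
elim: gs => [_|g gs IHgs /= [hg /IHgs[hs hhs hsE]]].
  by exists [::] => // c c'; split=> // _ [].
have [fs hfs fsE] := line_code hg; exists (fs ++ hs); first exact: DFs_cat.
move=> c c'; have [fs_eq fs_lt] := fsE c c'; have [hs_eq hs_lt] := hsE c c'.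
split=> [all_eq | all_le [t lt_t]].
  by apply/agree_cat; split; [apply: fs_eq | apply: hs_eq] => t; case: (all_eq t).
apply/lex_lt_cat.
have g_le s : g (s .: c) <= g (s .: c').
  by case: (all_le s) => [[-> _] | [/ltW | [-> _]]].
have [g_lt | g_nlt] := excluded_middle_informative (exists s, g (s .: c) < g (s .: c')).
  by left; exact: fs_lt.
have gE s : g (s .: c) = g (s .: c').
  apply/eqP; rewrite eq_le g_le leNgt; apply/negP => lt_s.
  by apply: g_nlt; exists s.
right; split; first exact: fs_eq.
apply: hs_lt; last by exists t; case: lt_t => [|[]//]; rewrite gE ltxx.
move=> s; case: (all_le s) => [[_] | [|[_]]]; [by left | by rewrite gE ltxx | by right].
Qed.

Definition prepend T (y : seq T) (v : nat -> T) : nat -> T := foldr (@scons T) v y.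

(** Variables are removed from the front. For each fixed tail of [y], [lines_code] replaces the
    values of [gs] by a tuple [hs] that is again equal or smaller, and smaller at the tail of the
    given witness. The clause on [agree] is what lets weak comparability survive this step. *)
Lemma block_code k gs : DFs gs ->
  exists2 fs, DFs fs & forall c c',
    ((forall y, size y = k -> agree gs (prepend y c) (prepend y c')) -> agree fs c c') /\
    ((forall y, size y = k ->
        agree gs (prepend y c) (prepend y c') \/ lex_ltZ gs (prepend y c) (prepend y c')) ->
     (exists2 y, size y = k & lex_ltZ gs (prepend y c) (prepend y c')) ->
     lex_ltZ fs c c').
Proof.
elim: k gs => [|k IHk] gs hgs.
  exists gs => // c c'; split=> [all_eq | _ [[]//]]; exact: (all_eq [::]).
have [hs hhs hsE] := lines_code hgs; have [fs hfs fsE] := IHk hs hhs.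
exists fs => // c c'; have [fs_eq fs_lt] := fsE c c'.
split=> [all_eq | all_le [[|x y] //= [yk] lt_xy]].
  apply: fs_eq => y yk; have [hs_eq _] := hsE (prepend y c) (prepend y c').
  by apply: hs_eq => t; apply: (all_eq (t :: y)); rewrite /= yk.
have hs_le z : size z = k -> forall t,
    agree gs (t .: prepend z c) (t .: prepend z c') \/
    lex_ltZ gs (t .: prepend z c) (t .: prepend z c').
  by move=> zk t; apply: (all_le (t :: z)); rewrite /= zk.
apply: fs_lt => [z zk|]; last first.
  exists y => //; have [_ hs_lt] := hsE (prepend y c) (prepend y c').
  by apply: hs_lt (hs_le y yk) _; exists x.
have [hs_eq hs_lt] := hsE (prepend z c) (prepend z c').
have [[t lt_t] | nlt] := excluded_middle_informative (exists t,
    lex_ltZ gs (t .: prepend z c) (t .: prepend z c')).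
  by right; apply: hs_lt (hs_le z zk) _; exists t.
left; apply: hs_eq => t; case: (hs_le z zk t) => // lt_t.
by case: nlt; exists t.
Qed.

(** Inclusion of sets is pointwise [<=] of their 0-1 valued functions, and a point in the difference
    makes it strict somewhere. *)
Lemma inclusion_code k R : QF R ->
  exists2 fs, DFs fs & forall c c',
    (forall y, size y = k -> R (prepend y c) -> R (prepend y c')) ->
    (exists2 y, size y = k & ~ R (prepend y c) /\ R (prepend y c')) ->
    lex_ltZ fs c c'.
Proof.
move=> [q qE]; pose chi v : int := qsem v q.
have hchi : DF chi.
  apply: (DF_if (QF_qsem q) (f := fun=> 1) (g := fun=> 0)).
  - by apply/DF_linear/linear_const.
  - by apply/DF_linear/linear_const.
  - by move=> v qv; rewrite /chi qv.
  - by move=> v /negP/negbTE qv; rewrite /chi qv.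
have [|fs hfs fsE] := @block_code k [:: chi]; first by [].
exists fs => // c c' incl [y yk [/qE/negP/negbTE nRy /qE Ry]].
have [_ fs_lt] := fsE c c'; apply: fs_lt => [z zk|] /=; last first.
  by exists y => //; left; rewrite /chi nRy Ry.
have := incl z zk; rewrite !qE /chi; case: (qsem _ q) => [-> //|_]; first by left.
by case: (qsem _ q); [right; left | left].
Qed.

(** * Formulas valid in all structures and transfer *)

Lemma lex_ltP T (lt : T -> T -> Prop) F0 fs c c' :
  lex_lt lt fs c c' <-> exists i, [/\ (i < size fs)%N,
    forall j, (j < i)%N -> nth F0 fs j c = nth F0 fs j c'
    & lt (nth F0 fs i c) (nth F0 fs i c')].
Proof.
elim: fs => [|f fs IHfs] /=; first by split=> // -[i []].
rewrite IHfs; split.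
  case=> [lt_f | [eq_f [i [ifs below at_i]]]]; first by exists 0%N; split.
  by exists i.+1; split=> // -[|j] //; exact: below.
case=> -[|i] [ifs below at_i]; first by left.
by right; split; [exact: (below 0%N) | exists i; split=> // j ji; exact: (below j.+1)].
Qed.

Lemma DFs_nth fs j : DFs fs -> (j < size fs)%N -> DF (nth (fun=> 0) fs j).
Proof. by elim: fs j => [|f fs IHfs] [|j] //= [hf hfs]; last exact: IHfs. Qed.

(** Valuations are kept infinite and cut off only when a formula is evaluated, so that renaming
    variables is composition. *)
Definition tup T n (v : nat -> T) : n.-tuple T := [tuple v i | i < n].

Lemma tup_scons T n (x : T) v : cons_tuple x (tup n v) = tup n.+1 (x .: v).
Proof.
apply: eq_from_tnth => i; rewrite tnth_mktuple (tnth_nth x).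
case: i => -[|i] //= lt_i.
by rewrite -(tnth_mktuple (fun j : 'I_n => v j) (Ordinal (lt_i : (i < n)%N))) (tnth_nth x).
Qed.

Lemma tup_nth T n x0 (t : n.-tuple T) : tup n (nth x0 t) = t.
Proof. by apply: eq_from_tnth => i; rewrite tnth_mktuple -tnth_nth. Qed.

Lemma linear_eval n (t : term n) : linear_form (fun v => @eval Z_structure n (tup n v) t).
Proof.
elim: t => [i | t1 IH1 t2 IH2] /=; last exact: linear_add.
by have [a [k E]] := linear_var i; exists a, k => v; rewrite tnth_mktuple.
Qed.

Lemma QF_formula n (phi : formula n) : QF (fun v => @sat Z_structure n (tup n v) phi).
Proof.
elim: phi => {n} n /=.
- by move=> t1 t2; apply: QF_eq; apply/DF_linear/linear_eval.
- by move=> t1 t2; apply: QF_lt; apply/DF_linear/linear_eval.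
- by move=> p; exact: QF_not.
- by move=> p IHp q; exact: QF_and.
- by move=> p IHp q; exact: QF_or.
- by move=> p IHp q; exact: QF_imp.
- move=> p /QF_ex; apply: QF_ext => v.
  by split=> -[x H]; exists x; move: H; rewrite tup_scons.
- move=> p /QF_all; apply: QF_ext => v.
  by split=> H x; move: (H x); rewrite tup_scons.
Qed.

Lemma rename_term n (t : term n) m (r : nat -> nat) :
  (forall i, (i < n)%N -> (r i < m)%N) ->
  exists t' : term m, forall (M : structure) (v : nat -> M),
    eval (tup m v) t' = eval (tup n (fun i => v (r i))) t.
Proof.
move=> rm; elim: t => [i | t1 [t1' E1] t2 [t2' E2]].
  by exists (TVar (Ordinal (rm i (ltn_ord i)))) => M v /=; rewrite !tnth_mktuple.
by exists (TAdd t1' t2') => M v /=; rewrite E1 E2.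
Qed.

Lemma rename_formula n (phi : formula n) m (r : nat -> nat) :
  (forall i, (i < n)%N -> (r i < m)%N) ->
  exists psi : formula m, forall (M : structure) (v : nat -> M),
    sat (tup m v) psi <-> sat (tup n (fun i => v (r i))) phi.
Proof.
elim: phi m r => {n} n.
- move=> t1 t2 m r rm; have [t1' E1] := rename_term t1 rm; have [t2' E2] := rename_term t2 rm.
  by exists (FEq t1' t2') => M v /=; rewrite E1 E2.
- move=> t1 t2 m r rm; have [t1' E1] := rename_term t1 rm; have [t2' E2] := rename_term t2 rm.
  by exists (FLt t1' t2') => M v /=; rewrite E1 E2.
- by move=> p IHp m r /IHp[p' E]; exists (FNot p') => M v /=; rewrite E.
- move=> p IHp q IHq m r rm; have [p' Ep] := IHp m r rm; have [q' Eq] := IHq m r rm.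
  by exists (FAnd p' q') => M v /=; rewrite Ep Eq.
- move=> p IHp q IHq m r rm; have [p' Ep] := IHp m r rm; have [q' Eq] := IHq m r rm.
  by exists (FOr p' q') => M v /=; rewrite Ep Eq.
- move=> p IHp q IHq m r rm; have [p' Ep] := IHp m r rm; have [q' Eq] := IHq m r rm.
  by exists (FImp p' q') => M v /=; rewrite Ep Eq.
all: move=> p IHp m r rm; pose r' i := if i is j.+1 then (r j).+1 else 0%N.
all: have [|p' E] := IHp m.+1 r'; first by case=> [|i] //; exact: rm.
all: have r'E (M : structure) (v : nat -> M) x :
  (fun i => (x .: v) (r' i)) = (x .: (fun i => v (r i))).
all: try by apply: functional_extensionality => -[].
- exists (FEx p') => M v /=.
  by split=> -[x H]; exists x; move: H; rewrite !tup_scons E r'E.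
- exists (FAll p') => M v /=.
  by split=> H x; move: (H x); rewrite !tup_scons E r'E.
Qed.

(** One formula without parameters has to work in all structures at once; this is what makes a
    property transferable. *)
Definition uniform (P : forall M : structure, (nat -> M) -> Prop) :=
  exists n (phi : formula n), forall (M : structure) (v : nat -> M),
    sat (tup n v) phi <-> P M v.

Lemma uniform_ext P Q : (forall M v, P M v <-> Q M v) -> uniform P -> uniform Q.
Proof. by move=> PQ [n [phi E]]; exists n, phi => M v; rewrite E PQ. Qed.

Lemma uniform_sat n (phi : formula n) : uniform (fun M v => sat (tup n v) phi).
Proof. by exists n, phi. Qed.

Lemma uniform_size P n : uniform P -> exists2 m, (n <= m)%N &
  exists phi : formula m, forall (M : structure) (v : nat -> M), sat (tup m v) phi <-> P M v.
Proof.
move=> [m [phi E]]; exists (m + n)%N; first exact: leq_addl.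
have [|psi psiE] := @rename_formula m phi (m + n) id.
  by move=> i im; exact: ltn_addr.
by exists psi => M v; rewrite psiE E.
Qed.

Lemma uniform_ren (r : nat -> nat) P :
  uniform P -> uniform (fun M v => P M (fun i => v (r i))).
Proof.
move=> [n [phi E]]; have [|psi psiE] := @rename_formula n phi (\max_(i < n) r i).+1 r.
  by move=> i ilt; rewrite ltnS (leq_bigmax (F := fun i : 'I_n => r i) (Ordinal ilt)).
by exists _, psi => M v; rewrite psiE E.
Qed.

Lemma uniform_pair P Q : uniform P -> uniform Q -> exists n (phi psi : formula n),
  forall (M : structure) (v : nat -> M),
  (sat (tup n v) phi <-> P M v) /\ (sat (tup n v) psi <-> Q M v).
Proof.
move=> [n [phi E]] [m [psi E']].
have [|phi1 E1] := @rename_formula n phi (n + m) id.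
  by move=> i lti; exact: ltn_addr.
have [|psi1 E1'] := @rename_formula m psi (n + m) id.
  by move=> i lti; exact: ltn_addl.
by exists (n + m)%N, phi1, psi1 => M v; rewrite E1 E1' E E'.
Qed.

Lemma uniform_not P : uniform P -> uniform (fun M v => ~ P M v).
Proof. by move=> [n [phi E]]; exists n, (FNot phi) => M v /=; rewrite E. Qed.

Lemma uniform_and P Q : uniform P -> uniform Q -> uniform (fun M v => P M v /\ Q M v).
Proof.
move=> hP /(uniform_pair hP)[n [phi [psi E]]].
by exists n, (FAnd phi psi) => M v /=; have [-> ->] := E M v.
Qed.

Lemma uniform_or P Q : uniform P -> uniform Q -> uniform (fun M v => P M v \/ Q M v).
Proof.
move=> hP /(uniform_pair hP)[n [phi [psi E]]].
by exists n, (FOr phi psi) => M v /=; have [-> ->] := E M v.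
Qed.

Lemma uniform_imp P Q : uniform P -> uniform Q -> uniform (fun M v => P M v -> Q M v).
Proof.
move=> hP /(uniform_pair hP)[n [phi [psi E]]].
by exists n, (FImp phi psi) => M v /=; have [-> ->] := E M v.
Qed.

Lemma uniform_ex P : uniform P -> uniform (fun M v => exists x, P M (x .: v)).
Proof.
move=> /(@uniform_size _ 1)[[|n] // _ [phi E]]; exists n, (FEx phi) => M v /=.
by split=> -[x H]; exists x; move: H; rewrite tup_scons E.
Qed.

Lemma uniform_all P : uniform P -> uniform (fun M v => forall x, P M (x .: v)).
Proof.
move=> /(@uniform_size _ 1)[[|n] // _ [phi E]]; exists n, (FAll phi) => M v /=.
by split=> H x; move: (H x); rewrite tup_scons E.
Qed.

Lemma uniform_eq i j : uniform (fun M v => v i = v j).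
Proof.
have hi : (i < (i + j).+1)%N by rewrite ltnS leq_addr.
have hj : (j < (i + j).+1)%N by rewrite ltnS leq_addl.
exists _, (FEq (TVar (Ordinal hi)) (TVar (Ordinal hj))) => M v /=.
by rewrite !tnth_mktuple.
Qed.

Lemma uniform_lt i j : uniform (fun M v => slt (v i) (v j)).
Proof.
have hi : (i < (i + j).+1)%N by rewrite ltnS leq_addr.
have hj : (j < (i + j).+1)%N by rewrite ltnS leq_addl.
exists _, (FLt (TVar (Ordinal hi)) (TVar (Ordinal hj))) => M v /=.
by rewrite !tnth_mktuple.
Qed.

Lemma uniform_add i j l : uniform (fun M v => v i = sadd (v j) (v l)).
Proof.
have hi : (i < (i + j + l).+1)%N by lia.
have hj : (j < (i + j + l).+1)%N by lia.
have hl : (l < (i + j + l).+1)%N by lia.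
exists _, (FEq (TVar (Ordinal hi)) (TAdd (TVar (Ordinal hj)) (TVar (Ordinal hl)))).
by move=> M v /=; rewrite !tnth_mktuple.
Qed.

Lemma uniform_true : uniform (fun M v => True).
Proof. by apply: uniform_ext (uniform_eq 0 0). Qed.

Lemma uniform_forall_lt n (P : nat -> forall M : structure, (nat -> M) -> Prop) :
  (forall j, (j < n)%N -> uniform (P j)) ->
  uniform (fun M v => forall j, (j < n)%N -> P j M v).
Proof.
elim: n => [|n IHn] hP; first by apply: uniform_ext uniform_true.
have h1 := IHn (fun j jn => hP j (ltnW jn)).
apply: uniform_ext (uniform_and h1 (hP n (ltnSn n))) => M v; split.
  by case=> H Hn j; rewrite ltnS leq_eqVlt => /predU1P[-> | /H].
by move=> H; split=> [j jn|]; apply: H => //; exact: ltnW.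
Qed.

Lemma uniform_exists_lt n (P : nat -> forall M : structure, (nat -> M) -> Prop) :
  (forall j, (j < n)%N -> uniform (P j)) ->
  uniform (fun M v => exists2 j, (j < n)%N & P j M v).
Proof.
elim: n => [|n IHn] hP.
  by apply: uniform_ext (uniform_not uniform_true) => M v; split=> [[] | []].
have h1 := IHn (fun j jn => hP j (ltnW jn)).
apply: uniform_ext (uniform_or h1 (hP n (ltnSn n))) => M v; split.
  by case=> [[j jn Pj] | Pn]; [exists j => //; exact: ltnW | exists n].
case=> j; rewrite ltnS leq_eqVlt => /predU1P[-> | jn] Pj; [by right | by left; exists j].
Qed.

Lemma uniform_ex_block k P :
  uniform P -> uniform (fun M v => exists2 y, size y = k & P M (prepend y v)).
Proof.
elim: k P => [|k IHk] P hP.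
  apply: uniform_ext hP => M v; split=> [Pv | [[] //]]; by exists [::].
apply: uniform_ext (IHk _ (uniform_ex hP)) => M v; split.
  by move=> [y yk [x Pxy]]; exists (x :: y); rewrite //= yk.
by move=> [[|x y] //= [yk] Pxy]; exists y => //; exists x.
Qed.

Lemma uniform_all_block k P :
  uniform P -> uniform (fun M v => forall y, size y = k -> P M (prepend y v)).
Proof.
elim: k P => [|k IHk] P hP.
  by apply: uniform_ext hP => M v; split=> [Pv [] | H] //; exact: (H [::]).
apply: uniform_ext (IHk _ (uniform_all hP)) => M v; split.
  by move=> H [|x y] //= [yk]; exact: H.
by move=> H y yk x; apply: (H (x :: y)); rewrite /= yk.
Qed.

(** * Transfer from the integers, and definability without constants *)

Lemma universal_closure n (phi : formula n) : exists s : sentence,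
  forall M, holds M s <-> forall v : n.-tuple M, sat v phi.
Proof.
elim: n phi => [|n IHn] phi.
  exists phi => M; split=> [H v | H]; last exact: H.
  by rewrite (tuple0 v).
have [s E] := IHn (FAll phi); exists s => M; rewrite E; split=> H v.
  by rewrite (tuple_eta v); exact: (H (behead_tuple v) (thead v)).
by move=> x; exact: H.
Qed.

(** The universal closure of the defining formula is a sentence true in the integers, hence it
    belongs to [PrA]. *)
Lemma transfer P (M : structure) : uniform P -> model_of PrA M ->
  (forall v, P Z_structure v) -> forall v, P M v.
Proof.
move=> [n [phi E]] hM PZ v; have [s sE] := universal_closure phi.
have hs : holds M s.
  by apply: hM; apply/sE => w; rewrite -(tup_nth (0 : int) w); apply/E/PZ.
by apply/E; exact: (proj1 (sE M) hs).
Qed.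

(* [P] is defined over the integers by a formula, without parameters. *)
Definition UZ (P : env -> Prop) :=
  exists2 Q, uniform Q & forall v : env, Q Z_structure v <-> P v.

Lemma UZ_ext P Q : (forall v, P v <-> Q v) -> UZ P -> UZ Q.
Proof. by move=> PQ [R hR RE]; exists R => // v; rewrite RE PQ. Qed.

Lemma UZ_ren (r : nat -> nat) P : UZ P -> UZ (fun v => P (fun i => v (r i))).
Proof. by move=> [Q /(uniform_ren r) hQ QE]; eexists; [exact: hQ | move=> v; apply: QE]. Qed.

Lemma UZ_not P : UZ P -> UZ (fun v => ~ P v).
Proof. by move=> [Q /uniform_not hQ QE]; eexists; [exact: hQ | move=> v /=; rewrite QE]. Qed.

Lemma UZ_and P P' : UZ P -> UZ P' -> UZ (fun v => P v /\ P' v).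
Proof.
move=> [Q hQ QE] [Q' hQ' QE']; eexists; first exact: uniform_and hQ hQ'.
by move=> v /=; rewrite QE QE'.
Qed.

Lemma UZ_ex P : UZ P -> UZ (fun v => exists x, P (x .: v)).
Proof.
move=> [Q /uniform_ex hQ QE]; eexists; first exact: hQ.
by move=> v /=; split=> -[x /QE]; exists x.
Qed.

Lemma UZ_eq i j : UZ (fun v => v i = v j).
Proof. by eexists; [exact: uniform_eq i j|]. Qed.

Lemma UZ_lt i j : UZ (fun v => v i < v j).
Proof. by eexists; [exact: uniform_lt i j|]. Qed.

Lemma UZ_add i j l : UZ (fun v => v i = v j + v l).
Proof. by eexists; [exact: uniform_add i j l|]. Qed.

Definition UZgraph (f : env -> int) := UZ (fun v => v 0%N = f (tl v)).

Lemma UZ_let f P : UZgraph f -> UZ P -> UZ (fun v => P (f v .: v)).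
Proof.
move=> hf hP; apply: UZ_ext (UZ_ex (UZ_and hf hP)) => v; split.
  by case=> y [/= ->].
by move=> Pf; exists (f v).
Qed.

Lemma UZgraph_ext f g : f =1 g -> UZgraph f -> UZgraph g.
Proof. by move=> fg; apply: UZ_ext => v; rewrite fg. Qed.

Lemma UZgraph_tl f : UZgraph f -> UZgraph (fun v => f (tl v)).
Proof. exact: (@UZ_ren (fun i => if i is j.+1 then j.+2 else 0%N)). Qed.

Lemma UZgraph_var i : UZgraph (fun v => v i).
Proof. exact: (UZ_eq 0 i.+1). Qed.

Lemma UZgraph_zero : UZgraph (fun=> 0).
Proof. by apply: UZ_ext (UZ_add 0 0 0) => v; lia. Qed.

Lemma UZgraph_one : UZgraph (fun=> 1).
Proof.
(* One is the least positive integer: nothing lies strictly between zero and it. *)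
have := UZ_let UZgraph_zero (UZ_and (UZ_lt 0 1) (UZ_not (UZ_ex (UZ_and (UZ_lt 1 0) (UZ_lt 0 2))))).
apply: UZ_ext => v /=; split=> [[v0 least] | ->].
  have [|/eqP//] := boolP (v 0%N == 1); first by move/eqP.
  by move=> ?; case: least; exists 1; lia.
by split=> // -[x] /=; lia.
Qed.

Lemma UZgraph_add f g : UZgraph f -> UZgraph g -> UZgraph (fun v => f v + g v).
Proof.
move=> hf hg; apply: (UZ_let (P := fun w => w 1%N = w 0%N + g (tl (tl w))) (UZgraph_tl hf)).
exact: (UZ_let (P := fun w => w 2%N = w 1%N + w 0%N) (UZgraph_tl (UZgraph_tl hg)) (UZ_add 2 1 0)).
Qed.

Lemma UZgraph_opp f : UZgraph f -> UZgraph (fun v => - f v).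
Proof.
move=> hf; have := UZ_let UZgraph_zero (UZ_let (UZgraph_tl (UZgraph_tl hf)) (UZ_add 1 2 0)).
by apply: UZ_ext => v; rewrite /= -[tl (tl _)]/(tl v); lia.
Qed.

Lemma UZgraph_scale b f : UZgraph f -> UZgraph (fun v => b * f v).
Proof.
move=> hf; have hn (n : nat) : UZgraph (fun v => n%:Z * f v).
  elim: n => [|n IHn].
    by apply: UZgraph_ext UZgraph_zero => v; rewrite mul0r.
  by apply: UZgraph_ext (UZgraph_add hf IHn) => v; rewrite -addn1 PoszD; ring.
have [b0 | b0] := leP 0 b; first by rewrite -(gez0_abs b0).
by apply: UZgraph_ext (UZgraph_opp (hn `|b|%N)) => v; rewrite ltz0_abs //; ring.
Qed.

Lemma UZgraph_linear f : linear_form f -> UZgraph f.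
Proof.
move=> [a [k fE]]; suff ha : UZgraph (dot a).
  apply: UZgraph_ext (UZgraph_add ha (UZgraph_scale k UZgraph_one)) => v.
  by rewrite fE mulr1.
elim: a {fE} => [|b a IHa]; first exact: UZgraph_zero.
by apply: UZgraph_add (UZgraph_tl IHa); apply: UZgraph_scale; exact: UZgraph_var.
Qed.

(** The language has only [<] and [+]. Zero is the solution of [x = x + x], one is the least
    positive element, integer multiples are iterated sums, and divisibility is an existential
    statement. *)
Lemma QF_UZ P : QF P -> UZ P.
Proof.
move=> [q qE]; apply: UZ_ext (fun v => iff_sym (qE v)) _.
elim: q {qE} => [a k | d a k | q IHq | q IHq r IHr] /=.
- have hf : UZgraph (fun v => dot a v + k) by apply: UZgraph_linear; exists a, k.
  exact: UZ_let hf (UZ_let UZgraph_zero (UZ_lt 1 0)).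
- have hf : UZgraph (fun v => dot a v + k) by apply: UZgraph_linear; exists a, k.
  have hd := UZgraph_scale d.+1%:Z (UZgraph_var 0).
  have := UZ_let hf (UZ_ex (UZ_let hd (UZ_eq 0 2))).
  apply: UZ_ext => v /=; split=> [[x E] | /dvdzP[x E]].
    by apply/dvdzP; exists x; rewrite -E mulrC.
  by exists x; rewrite E mulrC.
- by apply: UZ_ext (UZ_not IHq) => v; split=> /negP.
- by apply: UZ_ext (UZ_and IHq IHr) => v; split=> /andP.
Qed.

(** * The embedding *)

Lemma prependE T (x0 : T) y v i :
  prepend y v i = if (i < size y)%N then nth x0 y i else v (i - size y)%N.
Proof. by elim: y v i => [|x y IHy] v [|i] //=; rewrite IHy. Qed.

Lemma prepend_cat T (x y : seq T) v : prepend (x ++ y) v = prepend x (prepend y v).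
Proof. exact: foldr_cat. Qed.

Lemma cat_tup T k m (x : k.-tuple T) (w : nat -> T) :
  cat_tuple x (tup m w) = tup (k + m) (prepend x w).
Proof.
apply: eq_from_tnth => i; rewrite tnth_mktuple (tnth_nth (w 0%N)) /=.
rewrite (prependE (w 0%N)) nth_cat size_tuple; case: ltnP => // ki.
have im : (i - k < m)%N by rewrite ltn_subLR // ltn_ord.
by rewrite -(tnth_mktuple (fun j : 'I_m => w j) (Ordinal im)) (tnth_nth (w 0%N)).
Qed.

Lemma tup_prepend T m (p : m.-tuple T) w : tup m (prepend p w) = p.
Proof.
apply: eq_from_tnth => i; rewrite tnth_mktuple (tnth_nth (w 0%N)).
by rewrite (prependE (w 0%N)) size_tuple ltn_ord.
Qed.

Lemma cat_tuple_inj T k m (x x' : k.-tuple T) (y y' : m.-tuple T) :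
  cat_tuple x y = cat_tuple x' y' -> x = x' /\ y = y'.
Proof.
move=> /(congr1 val) /= E.
have sz : size x = size x' by rewrite !size_tuple.
have Ex : x = x' :> seq T.
  by move: E => /(congr1 (take k)); rewrite !take_size_cat ?size_tuple.
have Ey : y = y' :> seq T.
  by move: E => /(congr1 (drop k)); rewrite !drop_size_cat ?size_tuple.
by split; exact: val_inj.
Qed.

Lemma split_tuple T k m (z : (k + m).-tuple T) (x0 : T) :
  exists x y, z = cat_tuple x y :> (k + m).-tuple T.
Proof.
pose w := nth x0 z; exists (tup k w), (tup m (fun i => w (k + i)%N)).
rewrite cat_tup -[LHS](tup_nth x0); congr tup; apply: functional_extensionality => i.
rewrite (prependE x0) size_tuple; case: ltnP => ik; last by rewrite subnKC.
by rewrite -[RHS](tnth_nth x0 _ (Ordinal ik)) tnth_mktuple.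
Qed.

Lemma lex_tup (M : structure) n (u v : nat -> M) :
  lex (tup n u) (tup n v) <-> exists i, [/\ (i < n)%N,
    forall j, (j < i)%N -> u j = v j & slt (u i) (v i)].
Proof.
split=> [[i [below at_i]] | [i [lt_in below at_i]]].
  exists i; split=> // [j ji|]; last by move: at_i; rewrite !tnth_mktuple.
  have jn := ltn_trans ji (ltn_ord i).
  by have := below (Ordinal jn) ji; rewrite !tnth_mktuple.
exists (Ordinal lt_in); rewrite !tnth_mktuple; split=> // j ji.
by rewrite !tnth_mktuple below.
Qed.

Lemma uniform_subst (r : nat -> nat) P Q : uniform P ->
  (forall M v, Q M v <-> P M (fun i => v (r i))) -> uniform Q.
Proof.
by move=> /(uniform_ren r) hP QE; apply: uniform_ext hP => M v; rewrite QE.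
Qed.

(** [transfer] speaks of a single valuation, so the two valuations to be compared are interleaved
    into one. *)
Definition evens T (v : nat -> T) : nat -> T := fun i => v i.*2.
Definition odds T (v : nat -> T) : nat -> T := fun i => v i.*2.+1.

Lemma interleave T (c c' : nat -> T) : exists v, c = evens v /\ c' = odds v.
Proof.
exists (fun i => if odd i then c' i./2 else c i./2).
split; apply: functional_extensionality => i; rewrite /evens /odds /=.
  by rewrite odd_double doubleK.
by rewrite odd_double /= uphalf_double.
Qed.

(* [G j] is the graph of the [j]-th coordinate function. *)
Definition graph_lex n (G : nat -> forall M : structure, (nat -> M) -> Prop)
    (M : structure) (c c' : nat -> M) :=
  exists2 i, (i < n)%N &
    (forall j, (j < i)%N -> exists a, G j M (a .: c) /\ G j M (a .: c')) /\
    (exists a b, (G i M (a .: c) /\ G i M (b .: c')) /\ slt a b).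

Lemma graph_lexE (M : structure) n (G : nat -> forall M : structure, (nat -> M) -> Prop) F :
  (forall j, (j < n)%N -> forall v (y : M), G j M (y .: v) <-> y = F j v) ->
  forall c c' : nat -> M, graph_lex n G c c' <->
  exists i, [/\ (i < n)%N, forall j, (j < i)%N -> F j c = F j c' & slt (F i c) (F i c')].
Proof.
move=> GF c c'; split.
  move=> [i lt_in [below [a [b [[/(GF i lt_in)-> /(GF i lt_in)->] ab]]]]].
  exists i; split=> // j ji; have jn := ltn_trans ji lt_in.
  by have [x [/(GF j jn) <- /(GF j jn) <-]] := below j ji.
move=> [i [lt_in below at_i]]; exists i => //; split=> [j ji|].
  have jn := ltn_trans ji lt_in; exists (F j c).
  by split; apply/(GF j jn) => //; exact: below.
by exists (F i c), (F i c'); split=> //; split; apply/(GF i lt_in).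
Qed.

Lemma uniform_graph_lex n G : (forall j, uniform (G j)) ->
  uniform (fun M v => graph_lex n G (evens v) (odds v)).
Proof.
move=> hG; apply: uniform_exists_lt => i _; apply: uniform_and.
  apply: uniform_forall_lt => j _.
  apply: (@uniform_ex (fun M w => G j M (w 0%N .: evens (tl w)) /\ G j M (w 0%N .: odds (tl w)))).
  apply: uniform_and.
    apply: (@uniform_subst (fun l => if l is l'.+1 then l'.*2.+1 else 0%N) _ _ (hG j)) => M v.
    by rewrite (_ : (fun l => _) = v 0%N .: evens (tl v)) //;
      apply: functional_extensionality => -[].
  apply: (@uniform_subst (fun l => if l is l'.+1 then l'.*2.+2 else 0%N) _ _ (hG j)) => M v.
  by rewrite (_ : (fun l => _) = v 0%N .: odds (tl v)) //;
      apply: functional_extensionality => -[].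
apply: (@uniform_ex (fun M w => exists b, (G i M (w 0%N .: evens (tl w)) /\
  G i M (b .: odds (tl w))) /\ slt (w 0%N) b)).
apply: (@uniform_ex (fun M w => (G i M (w 1%N .: evens (tl (tl w))) /\
  G i M (w 0%N .: odds (tl (tl w)))) /\ slt (w 1%N) (w 0%N))).
apply: uniform_and (uniform_lt 1 0); apply: uniform_and.
  apply: (@uniform_subst (fun l => if l is l'.+1 then l'.*2.+2 else 1%N) _ _ (hG i)) => M v.
  by rewrite (_ : (fun l => _) = v 1%N .: evens (tl (tl v))) //;
      apply: functional_extensionality => -[].
apply: (@uniform_subst (fun l => if l is l'.+1 then l'.*2.+3 else 0%N) _ _ (hG i)) => M v.
by rewrite (_ : (fun l => _) = v 0%N .: odds (tl (tl v))) //;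
      apply: functional_extensionality => -[].
Qed.

(** Over the integers the code is given by formulas [G j]. That they define functions, and that
    these respect strict inclusion, are uniform properties because [n] is fixed; both therefore hold
    in [M], where the functions [F j] are read off. *)
Lemma inclusion_code_model (M : structure) k R : model_of PrA M -> uniform R ->
  exists n (G : nat -> forall M : structure, (nat -> M) -> Prop) (F : nat -> (nat -> M) -> M),
  [/\ forall j, uniform (G j),
      forall j, (j < n)%N -> forall v y, G j M (y .: v) <-> y = F j v
    & forall c c' : nat -> M,
      (forall y, size y = k -> R M (prepend y c) -> R M (prepend y c')) ->
      (exists2 y, size y = k & ~ R M (prepend y c) /\ R M (prepend y c')) ->
      lex (tup n (F^~ c)) (tup n (F^~ c'))].
Proof.
move=> hM hR; have RZ : QF (R Z_structure).
  by have [n [phi E]] := hR; apply: QF_ext (QF_formula phi) => v; rewrite E.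
have [fs hfs fsE] := inclusion_code k RZ; pose n := size fs.
have exG j : exists G, uniform G /\
    ((j < n)%N -> forall v : env, G Z_structure v <-> v 0%N = nth (fun=> 0) fs j (tl v)).
  (* A dummy beyond [n] makes [G j] uniform for every [j]. *)
  have [jn | nj] := ltnP j n; last by exists (fun _ _ => True); split=> //; exact: uniform_true.
  by have [G hG GE] := QF_UZ (DFs_nth hfs jn); exists G.
pose G j := proj1_sig (constructive_indefinite_description _ (exG j)).
have [hG GZ] : (forall j, uniform (G j)) /\ forall j, (j < n)%N ->
    forall v : env, G j Z_structure v <-> v 0%N = nth (fun=> 0) fs j (tl v).
  by split=> j; have [] := proj2_sig (constructive_indefinite_description _ (exG j)).
have functional j : (j < n)%N -> forall v : nat -> M,
    exists y, G j M (y .: v) /\ forall z, G j M (z .: v) -> z = y.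
  move=> jn; apply: (@transfer (fun M v => exists y : M,
    G j M (y .: v) /\ forall z, G j M (z .: v) -> z = y)) => // [|v].
    apply: (@uniform_ex (fun M w => G j M w /\ forall z, G j M (z .: tl w) -> z = w 0%N)).
    apply: uniform_and => //.
    apply: (@uniform_all (fun M w => G j M (w 0%N .: tl (tl w)) -> w 0%N = w 1%N)).
    apply: uniform_imp (uniform_eq 0 1).
    apply: (@uniform_subst (fun l => if l is l'.+1 then l'.+2 else 0%N) _ _ (hG j)) => N v.
    by rewrite (_ : (fun l => _) = v 0%N .: tl (tl v)) //;
      apply: functional_extensionality => -[].
  by exists (nth (fun=> 0) fs j v); split=> [|z]; rewrite GZ.
(* [M] is nonempty because the integers are; [x0] is the value of [F j] for [j] beyond [n]. *)
have [x0 _] : exists x : M, True.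
  have [|x _] := hM (FEx (FEq (TVar ord0) (TVar ord0))); first by exists (0 : int).
  by exists x.
have exF j (v : nat -> M) : exists y, (j < n)%N -> forall z, G j M (z .: v) <-> z = y.
  have [jn | nj] := ltnP j n; last by exists x0.
  by have [y [Gy uniq]] := functional j jn v; exists y => _ z; split=> [/uniq | ->].
pose F j v := proj1_sig (constructive_indefinite_description _ (exF j v)).
have FG j : (j < n)%N -> forall v y, G j M (y .: v) <-> y = F j v.
  by move=> jn v; exact: (proj2_sig (constructive_indefinite_description _ (exF j v)) jn).
exists n, G, F; split=> // c c' incl strict.
apply/lex_tup/(graph_lexE FG); have [v [cE c'E]] := interleave c c'.
move: incl strict; rewrite cE c'E {c c' cE c'E}; move: v.
(* The first [k] coordinates stay in place and only the parameters are re-indexed, to the even or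
   the odd positions. *)
have hRr (r : nat -> nat) : uniform (fun N w =>
    R N (fun i => w (if (i < k)%N then i else k + r (i - k))%N)) by exact: uniform_ren.
have prependR (N : structure) (r : nat -> nat) (y : seq N) v : size y = k ->
    (fun i => prepend y v (if (i < k)%N then i else k + r (i - k))%N) =
    prepend y (fun i => v (r i)).
  move=> yk; apply: functional_extensionality => i; rewrite !(prependE (v 0%N)) yk.
  by case: (ltnP i k) => [-> // | _]; rewrite ltnNge leq_addr /= addKn.
apply: (@transfer (fun N v =>
  (forall y, size y = k -> R N (prepend y (evens v)) -> R N (prepend y (odds v))) ->
  (exists2 y, size y = k & ~ R N (prepend y (evens v)) /\ R N (prepend y (odds v))) ->
  graph_lex n G (evens v) (odds v))) => //.
  apply: uniform_imp.
    apply: uniform_ext (uniform_all_block k (uniform_imp (hRr double) (hRr (fun i => i.*2.+1)))).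
    by move=> N v; split=> H y yk; have := H y yk;
      rewrite (prependR _ double y v yk) (prependR _ (fun i => i.*2.+1) y v yk).
  apply: uniform_imp (uniform_graph_lex n hG).
  apply: uniform_ext (uniform_ex_block k
    (uniform_and (uniform_not (hRr double)) (hRr (fun i => i.*2.+1)))).
  by move=> N v; split=> -[y yk H]; exists y => //; move: H;
    rewrite (prependR _ double y v yk) (prependR _ (fun i => i.*2.+1) y v yk).
move=> v incl strict; apply/(@graph_lexE Z_structure n G (fun j => nth (fun=> 0) fs j)).
  by move=> j jn w y; rewrite GZ.
exact/(proj1 (lex_ltP _ _ _ _ _))/fsE.
Qed.

Close Scope ring_scope.

Theorem theorem1p3 (M : structure) (hM : model_of PrA M)
    (k : nat) (hk : 0 < k)
    (D : k.-tuple M -> Prop) (ltL : k.-tuple M -> k.-tuple M -> Prop)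
    (hL : definable_linear_order D ltL) :
  exists (n : nat) (f : k.-tuple M -> n.-tuple M),
    [/\ definable_map D f,
        (forall a b, D a -> D b -> f a = f b -> a = b)
      & (forall a b, D a -> D b -> (ltL a b <-> lex (f a) (f b)))].
Proof.
have [[_ ltL_irr ltL_trans ltL_total] [mD [phiD [pD DE]]] [mR [phiR [pR RE]]]] := hL.
have [x0 _] : exists x : M, True.
  have [|x _] := hM (FEx (FEq (TVar ord0) (TVar ord0))); first by exists (Posz 0).
  by exists x.
pose w := nth x0 pR.
have ltE a b : ltL a b <-> sat (tup (k + k + mR) (prepend a (prepend b w))) phiR.
  rewrite -prepend_cat -[a ++ b]/(val (cat_tuple a b)) -cat_tup (tup_nth x0 pR) -RE.
  by split=> [lt_ab | [x [y [/cat_tuple_inj[-> ->]]]] //]; exists a, b.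
have [n [G [F [hG GF mono]]]] := inclusion_code_model k hM (uniform_sat phiR).
(* With [code a] as parameters, [phiR] defines the initial segment of the elements below [a]. *)
pose code (a : k.-tuple M) := prepend a w.
pose f a := tup n (F^~ (code a)).
have f_mono a b : ltL a b -> lex (f a) (f b).
  move=> lt_ab; apply: mono => [y yk|].
    have yk' : size y == k by apply/eqP.
    by move=> /(ltE (Tuple yk') a) lt_ya; apply/(ltE (Tuple yk') b); exact: ltL_trans lt_ab.
  (* The inclusion of initial segments is strict because [a] lies below [b] but not below itself. *)
  exists (val a); first exact: size_tuple.
  by split; [move=> /(ltE a a); exact: ltL_irr | apply/ltE].
have slt_irr (x : M) : ~ slt x x.
  apply: (@transfer (fun M v => ~ slt (v 0%N) (v 0%N)) M _ hM _ (fun=> x)).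
    exact/uniform_not/uniform_lt.
  by move=> v /=; rewrite ltxx.
have slt_asym (x y : M) : slt x y -> ~ slt y x.
  apply: (@transfer (fun M v => slt (v 0%N) (v 1%N) -> ~ slt (v 1%N) (v 0%N)) M _ hM _ (x .: fun=> y)).
    by apply: uniform_imp (uniform_lt 0 1) (uniform_not (uniform_lt 1 0)).
  by move=> v /= /lt_gtF ->.
have lex_irr (u : n.-tuple M) : ~ lex u u by case=> i [_ /slt_irr].
have lex_asym (u v : n.-tuple M) : lex u v -> ~ lex v u.
  case=> i [below_i at_i] [j [below_j at_j]].
  have [ij | ji | /val_inj ij] := ltngtP i j.
  - by move: at_i; rewrite below_j //; apply: slt_irr.
  - by move: at_j; rewrite below_i //; apply: slt_irr.
  - by move: at_j; rewrite -ij; exact: slt_asym.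
exists n, f; split.
(* The variables of [E] are, in this order, the argument ([k]), the value ([n]), the parameters of
   [D] ([mD]) and those of the order; the re-indexings skip the blocks that a formula does not
   mention. *)
- pose E (N : structure) (v : nat -> N) :=
    sat (tup (k + mD) (fun i => v (if (i < k)%N then i else n + i)%N)) phiD /\
    forall j, (j < n)%N ->
      G j N (v (k + j)%N .: fun i => v (if (i < k)%N then i else n + mD + i)%N).
  have hE : uniform E.
    apply: uniform_and.
      exact: (uniform_ren (fun i => if (i < k)%N then i else n + i)%N (uniform_sat phiD)).
    apply: uniform_forall_lt => j _.
    apply: (@uniform_subst (fun l => if l is i.+1 then
      (if (i < k)%N then i else n + mD + i)%N else (k + j)%N) _ _ (hG j)) => N v.
    rewrite [X in _ <-> G j N X](_ : _ =
      v (k + j)%N .: fun i => v (if (i < k)%N then i else n + mD + i)%N) //.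
    by apply: functional_extensionality => -[].
  have [m [phi phiE]] := hE.
  (* Padding to [k + n + m] variables leaves exactly [m] parameters after the argument and the
     value, as [definable] requires. *)
  have [|psi psiE] := @rename_formula m phi (k + n + m) id; first by move=> i; exact: ltn_addl.
  exists m, psi, (tup m (prepend pD w)) => z; rewrite cat_tup psiE phiE.
  have [x [y ->]] := split_tuple z x0; rewrite -[val _]/(x ++ y) prepend_cat.
  have -> : E M (prepend x (prepend y (prepend pD w))) <-> D x /\ f x = y.
    rewrite /E; set u := prepend x _.
    have u_D : (fun i => u (if i < k then i else n + i)) = prepend x (prepend pD w).
      apply: functional_extensionality => i; rewrite /u !(prependE x0) !size_tuple.
      case: (ltnP i k) => [-> // | ki].
      rewrite ltnNge (leq_trans ki (leq_addl _ _)) /= ifN -?leqNgt ?leq_subRL; try lia.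
      by congr (if _ then nth _ _ _ else w _); lia.
    have u_code : (fun i => u (if i < k then i else n + mD + i)) = code x.
      apply: functional_extensionality => i; rewrite /u /code !(prependE x0) !size_tuple.
      case: (ltnP i k) => [-> // | ki].
      rewrite !ifN -?leqNgt; try lia.
      by congr (w _); lia.
    have u_y j : j < n -> u (k + j) = nth x0 y j.
      by move=> jn; rewrite /u !(prependE x0) !size_tuple ltnNge leq_addr /= addKn jn.
    rewrite u_D u_code -cat_tup tup_prepend -DE; split=> -[Dx Gy]; split=> //.
      apply: eq_from_tnth => i; rewrite tnth_mktuple (tnth_nth x0) -u_y //.
      by apply/esym/(GF i (ltn_ord i))/Gy.
    move=> j jn; apply/(GF j jn); rewrite u_y // -Gy.
    by rewrite -[j]/(val (Ordinal jn)) -tnth_nth tnth_mktuple.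
  split=> [[x' [y' [/cat_tuple_inj[-> ->]]]] // | H]; by exists x, y.
(* Since [ltL] is total and [f] strictly monotone, injectivity follows from irreflexivity of [lex],
   and the converse implication from its irreflexivity and asymmetry. *)
- move=> a b Da Db fab; case: (ltL_total a b Da Db) => // /f_mono.
    by rewrite fab => /lex_irr.
  by rewrite fab => /lex_irr.
- move=> a b Da Db; split; first exact: f_mono.
  case: (ltL_total a b Da Db) => // [-> /lex_irr // | /f_mono lt_ba lt_ab].
  by case: (lex_asym _ _ lt_ab).
Qed.
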